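(* Let $(V,Y,\mathbf 1,\omega)$ be a vertex operator algebra and let $h\in V$ be such that $L(n)h=\delta_{n,0}h$ and $h_nh=\delta_{n,1}\gamma\mathbf 1$ for all $n\ge 0$, where $\gamma$ is a fixed rational number. Assume that $h(0)=h_0$ acts semisimply on $V$ with rational eigenvalues and that the automorphism $\sigma_h=e^{2\pi i h(0)}$ of $V$ is of finite order. Set $\tilde\omega=\omega+\frac12L(-1)h$. Let $W=(W,Y)$ be a $V$-module and let $(W',Y')$ denote the contragredient module of $W$ (with respect to $\omega$). Identify $W$ with $(W')'$ canonically as a vector space. Then $(W,(Y')'_{\tilde\omega})$ is isomorphic to $(W,Y(\Delta(h,z)e^{-\frac12\pi i h(0)}\,\cdot\,,z))$ as a $\sigma_h$-twisted $V$-module, where $(Y')'_{\tilde\omega}$ denotes the contragredient dual of $Y'$ with respect to the conformal vector $\tilde\omega$.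
   Context: Notation: $Y(v,z)=\sum_{n\in\mathbb Z}v_nz^{-n-1}$, $h(n)=h_n$, $Y(\omega,z)=\sum_{n\in\mathbb Z}L(n)z^{-n-2}$, $Y(\tilde\omega,z)=\sum_{n\in\mathbb Z}\tilde L(n)z^{-n-2}$. The vector $\tilde\omega$ is a conformal vector, with which $V$ is in general a $\mathbb Q$-graded vertex operator algebra (all axioms of a vertex operator algebra hold except that the grading is by $\mathbb Q$ instead of $\mathbb Z$), and $\tilde L(m)=L(m)-\frac12(m+1)h(m)$. On $V$, the operators $z^{h(0)}$, $e^{ch(0)}$, $z^{-2\tilde L(0)}$, $e^{\pi i\tilde L(0)}$ act on an eigenvector with eigenvalue $\lambda$ (of $h(0)$, resp. of $\tilde L(0)$) by $z^\lambda$, $e^{c\lambda}$, $z^{-2\lambda}$, $e^{\pi i\lambda}$ respectively. $\Delta(h,z)=z^{h(0)}\exp\left(\sum_{k\ge1}\frac{h(k)}{-k}(-z)^{-k}\right)$, acting on $V$. Contragredient module. For a $V$-module $W=\bigoplus_{\alpha\in\mathbb C}W_{(\alpha)}$ (graded by $L(0)$-weight), $W'=\bigoplus_\alpha W_{(\alpha)}^*$ is the restricted dual, and $Y'$ is defined by $$\langle Y'(v,z)w',w\rangle=\langle w',Y(e^{zL(1)}e^{\pi iL(0)}z^{-2L(0)}v,z^{-1})w\rangle\qquad(v\in V,\ w'\in W',\ w\in W).$$ The contragredient dual of $Y'$ with respect to $\tilde\omega$ is given by the same formula applied to $(W',Y')$ with $\tilde L(1),\tilde L(0)$ in place of $L(1),L(0)$;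 after identifying $W$ with $(W')'$ as a vector space it is characterized by $$\langle v',(Y')'_{\tilde\omega}(v,z)u\rangle=\langle Y'(e^{z\tilde L(1)}e^{\pi i\tilde L(0)}z^{-2\tilde L(0)}v,z^{-1})v',u\rangle\qquad(v\in V,\ u\in W,\ v'\in W').$$ Twisted modules. Let $\sigma$ be an automorphism of $V$ of finite order $k$, $\omega_k=e^{2\pi i/k}$, $V^j=\{a\in V:\sigma(a)=\omega_k^ja\}$. A $\sigma$-twisted module for $V$ as a vertex algebra is a vector space $W$ with a linear map $Y_W:V\to\mathrm{Hom}(W,W((x^{1/k})))$ such that $Y_W(\mathbf 1,x)=1$, $Y_W(\sigma v,x)=\lim_{x^{1/k}\to\omega_k^{-1}x^{1/k}}Y_W(v,x)$ for $v\in V$, and for $u\in V^j$, $v\in V$, $0\le j\le k-1$, $$x_0^{-1}\delta\left(\tfrac{x_1-x_2}{x_0}\right)Y_W(u,x_1)Y_W(v,x_2)-x_0^{-1}\delta\left(\tfrac{x_2-x_1}{-x_0}\right)Y_W(v,x_2)Y_W(u,x_1)=x_2^{-1}\left(\tfrac{x_1-x_0}{x_2}\right)^{-j/k}\delta\left(\tfrac{x_1-x_0}{x_2}\right)Y_W(Y(u,x_0)v,x_2).$$ For $V$ a vertex operator algebra, a $\sigma$-twisted $V$-module is moreover by definition $\mathbb C$-graded by the $L(0)$-weight and satisfies the two usual grading restrictions (the homogeneous subspaces are finite-dimensional and the grading is truncated from below in the usual sense). An isomorphism of twisted modules is a linear bijection intertwining the vertex operator maps.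
   Formalization: Twisted modules use ω_k=e^{-2πi/k} (with e^{2πi/k} the structures are σ_h^{-1}-twisted). The L(0)-grading restrictions can fail (V=V^k(sl_2), h half the coroot), so they are not asserted: it is shown that one structure satisfies them iff the other does. *)

(* Defs.v *)
From HB Require Import structures.
From mathcomp Require Export all_boot all_order all_algebra.
From mathcomp Require Export all_classical reals trigo.
From mathcomp Require Export complex.

Set Implicit Arguments.
Unset Strict Implicit.
Unset Printing Implicit Defensive.

Export Order.TTheory GRing.Theory Num.Theory.
Open Scope classical_set_scope.
Open Scope ring_scope.

(* The ground field is R[i] with R : realType, i.e. the complex numbers.

   A vertex operator Y(v,z) = \sum_n v_n z^(-n-1) is the family of its modes:
   Y v n w stands for v_n w.  The index n is an [int] for untwisted operators
   and a [rat] when fractional powers of z occur.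

   A formal series in rational powers of z is its coefficient function
   [rat -> V] (the value at s is the coefficient of z^s).  The sums
   \sum_(i \in A) _ are finitely supported sums; the axioms below make all the
   sums written here finite. *)

Section Scalars.
Variable R : realType.

(* e^(pi i q) *)
Definition expipi (q : rat) : R[i] :=
  Complex (cos (pi * ratr q)) (sin (pi * ratr q)).

(* generalized binomial coefficient a (a - 1) ... (a - i + 1) / i! *)
Definition gbinom (a : rat) (i : nat) : R[i] :=
  ratr ((\prod_(j < i) (a - j%:R)) / i`!%:R).

End Scalars.

Section Operators.
Variables (R : realType) (V : lmodType R[i]).
Implicit Types (T : V -> V) (v : V).

(* v = \sum_i p i is a (finite) decomposition into T-eigenvectors, p i having
   eigenvalue ev i *)
Definition eigen_decomp (I : choiceType) (ev : I -> R[i]) T v (p : I -> V) :=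
  [/\ finite_set [set i | p i != 0],
      forall i, T (p i) = ev i *: p i
    & v = \sum_(i \in [set: I]) p i].

(* T acts semisimply, with all its eigenvalues in the image of ev *)
Definition semisimple (I : choiceType) (ev : I -> R[i]) T :=
  forall v, exists p, eigen_decomp ev T v p.

(* component of v in the q-eigenspace of T, for T semisimple with rational
   eigenvalues *)
Definition eigen_comp T v : rat -> V :=
  xget (fun=> 0) [set p | eigen_decomp ratr T v p].

(* e^(c pi i T) *)
Definition expipi_op T (c : rat) v : V :=
  \sum_(q \in [set: rat]) expipi R (c * q) *: eigen_comp T v q.

Definition has_order T (k : nat) :=
  [/\ (0 < k)%N, iter k T =1 id
    & forall j, (0 < j < k)%N -> ~ (iter j T =1 id)].

(* Series A = \sum_(n >= 0) A_n x^n with coefficients A_n : V -> V. *)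
Definition opser_mul (A B : nat -> V -> V) : nat -> V -> V :=
  fun n v => \sum_(i < n.+1) A i (B (n - i)%N v).

Definition opser_one : nat -> V -> V := fun n v => if n == 0%N then v else 0.

(* exp A = \sum_m A^m / m!, for A_0 = 0: then (A^m)_n = 0 for m > n *)
Definition opser_exp (A : nat -> V -> V) : nat -> V -> V :=
  fun n v =>
    \sum_(m < n.+1) (m`!%:R)^-1 *: iter m (opser_mul A) opser_one n v.

(* e^(z T1) e^(pi i T0) z^(-2 T0) v *)
Definition contra_ser (T1 T0 : V -> V) v : rat -> V := fun s =>
  \sum_(x \in [set x : rat * nat | x.2%:R - 2 * x.1 = s])
    ((x.2`!%:R)^-1 * expipi R x.1) *: iter x.2 T1 (eigen_comp T0 v x.1).

End Operators.

Definition finite_dim (R : realType) (V : lmodType R[i]) (A : set V) :=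
  exists (d : nat) (b : 'I_d -> V), forall v, A v ->
    exists c : 'I_d -> R[i], v = \sum_(i < d) c i *: b i.

(* The C-grading by the eigenvalues of L0 and the two grading restrictions;
   truncation from below is along each coset alpha + Z. *)
Record weight_graded (R : realType) (W : lmodType R[i]) (L0 : W -> W) : Prop :=
  WeightGraded {
    wg_decomp : semisimple (fun a : R[i] => a) L0;
    wg_findim : forall a : R[i], finite_dim [set w | L0 w = a *: w];
    wg_trunc : forall a : R[i], exists N : int, forall n : int, n < N ->
      forall w, L0 w = (a + n%:~R) *: w -> w = 0 }.

Section VertexAlgebra.
Variables (R : realType) (V : lmodType R[i]).
Variables (Y : V -> int -> V -> V) (vac omega : V).

(* Jacobi identity
     x0^-1 d((x1-x2)/x0) YW(u,x1) YW(v,x2)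
       - x0^-1 d((x2-x1)/(-x0)) YW(v,x2) YW(u,x1)
     = x2^-1 d((x1-x0)/x2) YW(Y(u,x0)v,x2),
   as the equality of the coefficients of x0^(-l-1) x1^(-m-1) x2^(-n-1). *)
Definition jacobi (W : lmodType R[i]) (YW : V -> int -> W -> W) :=
  forall (u v : V) (w : W) (l m n : int),
    (\sum_(i \in [set: nat]) ((-1) ^+ i * gbinom R l%:~R i) *:
        YW u (l + m - i%:Z) (YW v (n + i%:Z) w))
  - (\sum_(i \in [set: nat]) ((-1) ^ (l + i%:Z) * gbinom R l%:~R i) *:
        YW v (l + n - i%:Z) (YW u (m + i%:Z) w))
  = \sum_(i \in [set: nat]) gbinom R m%:~R i *:
        YW (Y u (l + i%:Z) v) (m + n - i%:Z) w.

Record va_module (W : lmodType R[i]) (YW : V -> int -> W -> W) : Prop :=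
  VaModule {
    vam_linl : forall n w, linear (fun v => YW v n w);
    vam_linr : forall v n, linear (YW v n);
    vam_trunc : forall v w, exists N : int, forall n, N <= n -> YW v n w = 0;
    vam_vac : forall n w, YW vac n w = if n == -1 then w else 0;
    vam_jacobi : jacobi YW }.

Record vertex_algebra : Prop := VertexAlgebra {
  va_self : va_module Y;
  va_creation : forall v (n : nat), Y v n%:Z vac = 0;
  va_creation1 : forall v, Y v (-1) vac = v }.

(* L(n), for the vector a in place of omega *)
Definition Lop (W : Type) (YW : V -> int -> W -> W) (a : V) (n : int) : W -> W :=
  YW a (n + 1).

Record voa : Prop := VOA {
  voa_va : vertex_algebra;
  voa_virasoro : exists c : R[i], forall (m n : int) v,
    Lop Y omega m (Lop Y omega n v) - Lop Y omega n (Lop Y omega m v)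
    = (m - n)%:~R *: Lop Y omega (m + n) v
      + (if m + n == 0 then ((m ^+ 3 - m)%:~R / 12 * c) *: v else 0);
  voa_deriv : forall v n w,
    Y (Lop Y omega (-1) v) n w = - n%:~R *: Y v (n - 1) w;
  voa_grading : semisimple (fun n : int => n%:~R) (Lop Y omega 0);
  voa_findim : forall n : int,
    finite_dim [set v | Lop Y omega 0 v = n%:~R *: v];
  voa_trunc : exists N : int, forall n : int, n < N ->
    forall v, Lop Y omega 0 v = n%:~R *: v -> v = 0 }.

Record voa_module (W : lmodType R[i]) (YW : V -> int -> W -> W) : Prop :=
  VoaModule {
    vm_module : va_module YW;
    vm_graded : weight_graded (Lop YW omega 0) }.

(* The root of unity omega_k in the definition of a sigma-twisted module.
   Of the two conventions in use, e^(2 pi i/k) and e^(-2 pi i/k), which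
   exchange sigma-twisted and sigma^-1-twisted modules, only the second one
   makes Y(Delta(h,z) -, z) twisted by e^(2 pi i h(0)): if h(0)v = lambda v,
   then Y(Delta(h,z)v, z) only involves powers z^s with s in lambda + Z,
   while the twisted Jacobi identity forces s in -j/k + Z for v in V^j. *)
Definition twist_root (k : nat) : R[i] := expipi R (- 2 / k%:R).

(* Same as [jacobi] with right-hand side
     x2^-1 ((x1-x0)/x2)^(-j/k) d((x1-x0)/x2) YW(Y(u,x0)v,x2),
   whose exponents of x1 lie in -j/k + Z. *)
Definition twisted_jacobi (sigma : V -> V) (k : nat)
    (W : lmodType R[i]) (YW : V -> rat -> W -> W) :=
  forall (j : nat) (u v : V) (w : W) (l : int) (m n : rat), (j < k)%N ->
    sigma u = twist_root k ^+ j *: u ->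
    (\sum_(i \in [set: nat]) ((-1) ^+ i * gbinom R l%:~R i) *:
        YW u (l%:~R + m - i%:R) (YW v (n + i%:R) w))
  - (\sum_(i \in [set: nat]) ((-1) ^ (l + i%:Z) * gbinom R l%:~R i) *:
        YW v (l%:~R + n - i%:R) (YW u (m + i%:R) w))
  = if m - j%:R / k%:R \is a Num.int then
      \sum_(i \in [set: nat]) gbinom R m i *:
        YW (Y u (l + i%:Z) v) (m + n - i%:R) w
    else 0.

(* sigma-twisted module for V as a vertex algebra, sigma being an automorphism
   of finite order k.  In [tm_equiv] the coefficient of
   x^(-n/k-1) = (x^(1/k))^(-n-k) is compared on both sides of
   YW(sigma v,x) = lim_(x^(1/k) -> omega_k^-1 x^(1/k)) YW(v,x).
   For V a vertex operator algebra, a sigma-twisted V-module moreover satisfies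
   [weight_graded (YW omega 1)], omega_1 being L(0).  This is not automatic for
   Y(Delta(h,z) -, z), whose L(0) is L(0) + h(0) + gamma/2: on V = W = V^k(sl_2)
   with h half the coroot, all the f(-1)^n 1 have the same weight. *)
Record twisted_module (sigma : V -> V) (k : nat)
    (W : lmodType R[i]) (YW : V -> rat -> W -> W) : Prop :=
  TwistedModule {
    tm_linl : forall r w, linear (fun v => YW v r w);
    tm_linr : forall v r, linear (YW v r);
    tm_supp : forall v r w, YW v r w != 0 -> k%:R * r \is a Num.int;
    tm_trunc : forall v w, exists N : rat, forall r, N <= r -> YW v r w = 0;
    tm_vac : forall r w, YW vac r w = if r == -1 then w else 0;
    tm_equiv : forall v (n : int) w,
      YW (sigma v) (n%:~R / k%:R) w
      = twist_root k ^ (n + k%:Z) *: YW v (n%:~R / k%:R) w;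
    tm_jacobi : twisted_jacobi sigma k YW }.

Definition twisted_isomorphic (W1 W2 : lmodType R[i])
    (Y1 : V -> rat -> W1 -> W1) (Y2 : V -> rat -> W2 -> W2) :=
  exists phi : {linear W1 -> W2}, bijective phi /\
    forall v r w, phi (Y1 v r w) = Y2 v r (phi w).

(* Delta(h,z)v, where the n-th coefficient of the exponential is that of
   z^(-n), and (-z)^(-n) = (-1)^n z^(-n). *)
Definition Delta (h v : V) : rat -> V := fun s =>
  let E := opser_exp (fun n u =>
    if n == 0%N then 0 else ((-1) ^+ n / - n%:R) *: Y h n%:Z u) in
  \sum_(x \in [set x : rat * nat | x.1 - x.2%:R = s])
    eigen_comp (Y h 0) (E x.2 v) x.1.

Section Modules.
Variables (W : lmodType R[i]) (YW : V -> int -> W -> W).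

(* coefficient of z^(-r-1) in YW(d(z), z)w *)
Definition subst_vertex (d : rat -> V) (r : rat) (w : W) : W :=
  \sum_(m \in [set: int]) YW (d (m%:~R - r)) m w.

(* For F(v,z) = \sum_m F_m(v) z^(-m-1) scalar-valued, the coefficient of
   z^(-r-1) in F(e^(z T1) e^(pi i T0) z^(-2 T0) v, z^-1). *)
Definition contra_coef (T1 T0 : V -> V) (F : V -> int -> R[i])
    (v : V) (r : rat) : R[i] :=
  \sum_(m \in [set: int]) F (contra_ser T1 T0 v (- r - 2 - m%:~R)) m.

(* The restricted dual W', as the linear forms on W vanishing on all but
   finitely many of the weight spaces. *)
Definition restricted_dual (f : W -> R[i]) :=
  scalar f /\
  finite_set [set a : R[i] |
    exists2 w, Lop YW omega 0 w = a *: w & f w != 0].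

(* Y' on W', with respect to omega.  Its modes are integral because L(0) has
   integral eigenvalues on V. *)
Definition contragredient (v : V) (n : int) (f : W -> R[i]) : W -> R[i] :=
  fun w => contra_coef (Lop Y omega 1) (Lop Y omega 0)
    (fun a m => f (YW a m w)) v n%:~R.

(* Contragredient dual of (W', Y') with respect to the conformal vector
   omega', transported to W along the canonical identification of W with (W')',
   which sends x to the evaluation f |-> f x on W'. *)
Definition contragredient_dual (omega' : V) (v : V) (r : rat) (u : W) : W :=
  xget 0 [set x | forall f, restricted_dual f ->
    f x = contra_coef (Lop Y omega' 1) (Lop Y omega' 0)
            (fun a m => contragredient a m f u) v r].

End Modules.

End VertexAlgebra.

(* Main.v *)
(* For v homogeneous of L(0)-weight d and h(0)-weight lambda, moving both
   contragredients onto V turns the matrix coefficient of the double dual into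
   that of Y(A v, z), where
     A = e^(L(1)/z) e^(pi i L(0)) z^(2 L(0)) e^(z L~(1)) e^(pi i L~(0)) z^(-2 L~(0))
       = e^(L(1)/z) e^(-(L(1) - h(1))/z) z^(h(0)) e^(-pi i h(0)/2),
   because L~(0) = L(0) - h(0)/2 and L~(1) = L(1) - h(1). Put x = 1/z. The
   series e^(xL(1)) e^(-x(L(1) - h(1))) and exp(\sum_k h(k)/(-k) (-x)^k) solve
   the same differential equation Z' = (\sum_(k>0) (-1)^(k+1) h(k) x^(k-1)) Z,
   so A = Delta(h,z) e^(-pi i h(0)/2): the two vertex operator maps coincide and
   the isomorphism is the identity.

   That Y(Delta(h,z) -, z) satisfies the twisted Jacobi identity follows from
   the untwisted one and Vandermonde's convolution, once Delta(h,z) is commuted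
   with Y(u,x); the commutation formula comes from the same differential
   equation. *)

From mathcomp Require Import finmap ring lra zify.
Require Import Defs.

Set Implicit Arguments.
Unset Strict Implicit.
Unset Printing Implicit Defensive.

(** * Linear maps and finitely supported sums *)

(** The double dual is specified only through its pairings with W'. Existence of the specified
    vector comes from Y(Delta(h,z)e^(-pi i h(0)/2) -, z) itself; uniqueness holds because W'
    separates points, which rests on the finite-dimensional weight spaces of W. An infinite sum
    silently has value 0 when its support is infinite, so no interchange of sums is free. Statements
    linear in v are therefore reduced to eigenvectors of h(0), and of L(0) where needed. There the
    L(0)-grading of V, bounded below, truncates the series at some N, and formal identities become
    identities between finite sums. Differential equations are used coefficientwise, as recursions n
    Z_n = \sum_(k>0) H_k Z_(n-k). Fractional exponents disappear from the Jacobi identity because,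
    for h(0)u = lambda u, the expansion of (z+x)^(lambda-a) contributes binom(lambda-a,t) while the
    twisted identity contributes binom(m-lambda,i) with m integral: their convolution binom(m-a,i+t)
    is the coefficient of an untwisted identity. *)

Section LinearMaps.
Variables (K : comNzRingType) (U V W : lmodType K).
Implicit Types (f : U -> V) (g : V -> W).

Lemma lin0 f : linear f -> f 0 = 0.
Proof. by move=> lf; have := lf (-1) 0 0; rewrite scaler0 addr0 scaleN1r addNr. Qed.

Lemma linD f : linear f -> {morph f : u v / u + v}.
Proof. by move=> lf u v; have := lf 1 u v; rewrite !scale1r. Qed.

Lemma linZ f : linear f -> forall a, {morph f : u / a *: u}.
Proof. by move=> lf a u; have := lf a u 0; rewrite !addr0 lin0 // addr0. Qed.

Lemma linN f : linear f -> {morph f : u / - u}.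
Proof. by move=> lf u; rewrite -scaleN1r linZ // scaleN1r. Qed.

Lemma linB f : linear f -> {morph f : u v / u - v}.
Proof. by move=> lf u v; rewrite linD // linN. Qed.

Lemma lin_sum f : linear f -> forall (I : Type) (r : seq I) (P : pred I) (F : I -> U),
  f (\sum_(i <- r | P i) F i) = \sum_(i <- r | P i) f (F i).
Proof. by move=> lf I r P F; apply: big_morph; [exact: linD | exact: lin0]. Qed.

Lemma lin_comp f g : linear f -> linear g -> linear (g \o f).
Proof. by move=> lf lg a u v /=; rewrite lf lg. Qed.

Lemma lin_iter (f : U -> U) n : linear f -> linear (iter n f).
Proof. by move=> lf; elim: n => [//|n IH] a u v /=; rewrite IH lf. Qed.

Lemma lin_bigsum (I : Type) (r : seq I) (P : pred I) (F : I -> U -> V) :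
  (forall i, linear (F i)) -> linear (fun u => \sum_(i <- r | P i) F i u).
Proof.
by move=> lF a u v; rewrite scaler_sumr -big_split; apply: eq_bigr => i _ /=; rewrite lF.
Qed.

Lemma linZl (a : K) f :
  linear f -> linear (fun u => a *: f u).
Proof. by move=> lf b u v; rewrite lf scalerDr !scalerA mulrC. Qed.

Lemma lin_sub f f' : linear f -> linear f' -> linear (fun u => f u - f' u).
Proof. by move=> lf lf' a u v; rewrite lf lf' scalerBr opprD addrACA. Qed.

Lemma lin_if (b : bool) f : linear f -> linear (fun u => if b then f u else 0).
Proof. by case: b => // _ a u v; rewrite scaler0 addr0. Qed.

End LinearMaps.

Section FiniteSupport.
Variables (K : comNzRingType) (I : choiceType).

(** The list enumerates any finite [S] outside which [F] vanishes, so several sums can be moved to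
    one common list. *)
Lemma fsum_seq (M : zmodType) (A S : set I) (F : I -> M) :
  finite_set S -> S `<=` A -> (forall i, A i -> ~ S i -> F i = 0) ->
  \sum_(i \in A) F i = \sum_(i <- fset_set S) F i.
Proof.
move=> fS SA F0; rewrite -fsbig_finite //; apply/esym/fsbig_widen => //.
by move=> i [Ai Si]; apply: F0.
Qed.

(** A sum over [A] with infinite support is 0 by convention, so additivity and linearity of such
    sums fail without this condition. *)
Definition finsupp (M : zmodType) (A : set I) (F : I -> M) :=
  finite_set [set i | A i /\ F i <> 0].

Lemma fsum_lin (U V : lmodType K) (f : U -> V) (A : set I) (F : I -> U) :
  linear f -> finsupp A F -> f (\sum_(i \in A) F i) = \sum_(i \in A) f (F i).
Proof.
move=> lf fF; rewrite !(fsum_seq fF) ?(lin_sum lf) //.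
- by move=> i [].
- by move=> i Ai /not_andP[//|/contrapT ->]; rewrite lin0.
- by move=> i [].
- by move=> i Ai /not_andP[//|/contrapT ->].
Qed.

Lemma finsuppD (M : zmodType) (A : set I) (F G : I -> M) :
  finsupp A F -> finsupp A G -> finsupp A (fun i => F i + G i).
Proof.
move=> fF fG; have := fF; rewrite /finsupp => {}fF.
apply: sub_finite_set (_ : finite_set ([set i | A i /\ F i <> 0] `|` [set i | A i /\ G i <> 0])); last by rewrite finite_setU.
move=> i [Ai FG]; case: (EM (F i = 0)) => [F0|F0]; [right|by left].
by split=> // G0; apply: FG; rewrite F0 G0 addr0.
Qed.

Lemma fsumD (M : zmodType) (A : set I) (F G : I -> M) :
  finsupp A F -> finsupp A G ->
  \sum_(i \in A) (F i + G i) = \sum_(i \in A) F i + \sum_(i \in A) G i.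
Proof.
move=> fF fG.
pose S := [set i | A i /\ F i <> 0] `|` [set i | A i /\ G i <> 0].
have fS : finite_set S by rewrite finite_setU.
have SA : S `<=` A by move=> i [[]|[]].
have S0 i : ~ S i -> A i -> F i = 0 /\ G i = 0.
  by move=> /not_orP[nF nG] Ai; split; apply: contrapT => ?; [apply: nF|apply: nG].
rewrite !(fsum_seq fS SA) ?big_split //.
- by move=> i Ai nS; case: (S0 i nS Ai).
- by move=> i Ai nS; case: (S0 i nS Ai).
- by move=> i Ai nS; case: (S0 i nS Ai) => -> ->; rewrite addr0.
Qed.

Lemma finsupp_sum (M : zmodType) (A : set I) (J : Type) (r : seq J)
    (F : J -> I -> M) : (forall j, finsupp A (F j)) ->
  finsupp A (fun i => \sum_(j <- r) F j i).
Proof.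
move=> fF; elim: r => [|j r IH].
  by apply: sub_finite_set (finite_set0 I) => i [_]; rewrite big_nil.
have -> : (fun i => \sum_(j <- j :: r) F j i)
    = fun i => F j i + \sum_(j <- r) F j i.
  by apply/funext => i; rewrite big_cons.
exact: finsuppD.
Qed.

Lemma fsum_sum (M : zmodType) (A : set I) (J : Type) (r : seq J)
    (F : J -> I -> M) : (forall j, finsupp A (F j)) ->
  \sum_(i \in A) \sum_(j <- r) F j i = \sum_(j <- r) \sum_(i \in A) F j i.
Proof.
move=> fF; elim: r => [|j r IH].
  by rewrite big_nil fsbig1 // => i _; rewrite big_nil.
under eq_fsbigr do rewrite big_cons.
by rewrite fsumD // ?IH ?big_cons //; apply: finsupp_sum.
Qed.

Lemma fsumZ (M : lmodType K) (A : set I) a (F : I -> M) :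
  finsupp A F ->
  \sum_(i \in A) a *: F i = a *: \sum_(i \in A) F i.
Proof.
move=> fF; rewrite (@fsum_lin M M (fun x => a *: x)) //.
by move=> b u v; rewrite scalerDr !scalerA mulrC.
Qed.

End FiniteSupport.

Lemma fsum_ord (M : zmodType) (F : nat -> M) N :
  (forall i, (N <= i)%N -> F i = 0) ->
  \sum_(i \in [set: nat]) F i = \sum_(i < N) F i.
Proof.
move=> F0; rewrite fsbig_ord; apply/esym/fsbig_widen => //.
by move=> i [_ /negP]; rewrite -leqNgt => /F0.
Qed.

Lemma fsum_int_nat (M : zmodType) (F : int -> M) (m : int) N :
  (forall i, F i <> 0 -> exists2 n, (n < N)%N & i = m - n%:Z) ->
  \sum_(i \in [set: int]) F i = \sum_(n < N) F (m - n%:Z).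
Proof.
move=> F0; have minj : injective (fun n => m - n%:Z) by move=> a b /addrI/oppr_inj[].
rewrite (fsbig_ord _ N (fun n => F (m - n%:Z))).
rewrite -(@fsbig_image _ _ _ _ _ `I_N (fun n => m - n%:Z) F); last first.
  by move=> a b _ _; exact: minj.
apply/esym/fsbig_widen => // i [_ nI]; apply: contrapT => /F0[n nN iE].
by apply: nI; exists n.
Qed.

(** * Decompositions into eigenvectors *)

Section EigenDecomposition.
Variables (R : realType) (V : lmodType R[i]) (I : choiceType) (ev : I -> R[i]).
Hypothesis ev_inj : injective ev.
Variable T : V -> V.
Hypothesis T_lin : linear T.

(** Applying [T - ev a] to the vanishing sum kills the head and multiplies every other term by the
    nonzero scalar [ev i - ev a], which leaves a shorter sum of eigenvectors. *)
Lemma eigen_sum0 (s : seq I) (p : I -> V) : uniq s ->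
  (forall i, T (p i) = ev i *: p i) -> \sum_(i <- s) p i = 0 ->
  forall i, i \in s -> p i = 0.
Proof.
elim: s p => [//|a s IH] p /= /andP[as_ us] Tp; rewrite big_cons => p0.
have ps i : i \in s -> p i = 0.
  move=> si; have : (ev i - ev a) *: p i = 0.
    apply: (IH (fun i => (ev i - ev a) *: p i)) => // [j|].
      by rewrite (linZ T_lin) Tp !scalerA mulrC.
    under eq_bigr do rewrite scalerBl -Tp.
    rewrite sumrB -scaler_sumr -(lin_sum T_lin).
    have -> : \sum_(j <- s) p j = - p a by apply/eqP; rewrite -addr_eq0 addrC p0.
    by rewrite (linN T_lin) Tp scalerN subrr.
  move/eqP; rewrite scaler_eq0 subr_eq0 => /orP[/eqP/ev_inj ia|/eqP//].
  by rewrite -ia si in as_.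
move=> i; rewrite inE => /orP[/eqP->|/ps//].
by move: p0; rewrite big1_seq ?addr0 // => j /andP[_ /ps].
Qed.

(** Uniqueness is what makes the [xget] choice of components a linear function of the vector. *)
Lemma eigen_decomp_uniq v p p' :
  eigen_decomp ev T v p -> eigen_decomp ev T v p' -> p = p'.
Proof.
move=> [fp Tp ->] [fp' Tp' sE]; apply/funext => i.
pose S := [set i | p i != 0] `|` [set i | p' i != 0].
have fS : finite_set S by rewrite finite_setU.
have sT : S `<=` [set: I] by [].
have out j : ~ S j -> p j = 0 /\ p' j = 0.
  by move=> /not_orP[/negP + /negP]; rewrite !negbK => /eqP + /eqP.
have out0 q : q = p \/ q = p' -> forall j, [set: I] j -> ~ S j -> q j = 0.
  by move=> qE j _ /out[? ?]; case: qE => ->.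
move: sE; rewrite (fsum_seq fS sT (out0 p _)) ?(fsum_seq fS sT (out0 p' _)); auto.
move=> /eqP; rewrite -subr_eq0 -sumrB => /eqP s0.
case: (EM (S i)) => [Si|/out[-> ->]//].
apply/eqP; rewrite -subr_eq0; apply/eqP.
apply: (eigen_sum0 (p := fun j => p j - p' j)) s0 _ _ => //.
  by move=> j; rewrite (linB T_lin) Tp Tp' scalerBr.
by rewrite in_fset_set // inE.
Qed.

Lemma eigen_decomp0 : eigen_decomp ev T 0 (fun=> 0).
Proof.
split; last by rewrite fsbig1.
  by apply: sub_finite_set (finite_set0 I) => i /=; rewrite eqxx.
by move=> i; rewrite lin0 // scaler0.
Qed.

Lemma finsuppT (p : I -> V) :
  finite_set [set i | p i != 0] -> finsupp [set: I] p.
Proof. by apply: sub_finite_set => i [_ /eqP]. Qed.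

Lemma eigen_decompD a u v p q : eigen_decomp ev T u p -> eigen_decomp ev T v q ->
  eigen_decomp ev T (a *: u + v) (fun i => a *: p i + q i).
Proof.
move=> [fp Tp ->] [fq Tq ->]; split.
- apply: (@sub_finite_set _ _ ([set i | p i != 0] `|` [set i | q i != 0])).
    move=> i /=; apply: contraNP => /not_orP[/negP + /negP]; rewrite !negbK.
    by move=> /eqP-> /eqP->; rewrite scaler0 addr0.
  by rewrite finite_setU.
- by move=> i; rewrite T_lin Tp Tq scalerDr !scalerA mulrC.
- have fp' := finsuppT fp; have fq' := finsuppT fq.
  rewrite fsumD ?fsumZ //; apply: sub_finite_set fp' => i [_ ne]; split=> // p0.
  by apply: ne; rewrite p0 scaler0.
Qed.

Lemma eigen_decomp_eig v i : T v = ev i *: v ->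
  eigen_decomp ev T v (fun j => if j == i then v else 0).
Proof.
move=> Tv; split.
- by apply: sub_finite_set (finite_set1 i) => j /=; case: (j =P i) => // _; rewrite eqxx.
- by move=> j; case: eqP => [->//|_]; rewrite lin0 // scaler0.
- rewrite -(@fsbig_widen _ _ _ _ [set i]) ?fsbig_set1 ?eqxx //.
  by move=> j [_ /eqP/negbTE /= ->].
Qed.

(** Converse of [eigen_ind]. In this form the integral grading by [L0] can be reindexed by
    rationals, and [L0'] can be treated through joint eigenvectors of h(0) and L(0). *)
Lemma semisimple_gen :
  (forall P : V -> Prop, P 0 -> (forall u v, P u -> P v -> P (u + v)) ->
     (forall i v, T v = ev i *: v -> P v) -> forall v, P v) ->
  semisimple ev T.
Proof.
move=> gen; apply: gen.
- by exists (fun=> 0); exact: eigen_decomp0.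
- move=> u v [p up] [q vq]; exists (fun i => 1 *: p i + q i).
  by rewrite -[u]scale1r; exact: eigen_decompD.
- by move=> i v /eigen_decomp_eig; exists (fun j => if j == i then v else 0).
Qed.

Hypothesis T_ss : semisimple ev T.

Lemma eigen_ind (P : V -> Prop) : P 0 -> (forall u v, P u -> P v -> P (u + v)) ->
  (forall i v, T v = ev i *: v -> P v) -> forall v, P v.
Proof.
move=> P0 PD Pe v; have [p [fp Tp ->]] := T_ss v.
rewrite (fsum_seq fp) //; last by move=> i _ /negP; rewrite negbK => /eqP.
by apply: big_ind => // i _; apply: (Pe i).
Qed.

Definition ecomp v : I -> V := xget (fun=> 0) [set p | eigen_decomp ev T v p].

Lemma ecompP v : eigen_decomp ev T v (ecomp v).
Proof. by rewrite /ecomp; case: xgetP => // nP; have [p /nP] := T_ss v. Qed.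

Lemma ecomp_eq v p : eigen_decomp ev T v p -> ecomp v = p.
Proof. exact: eigen_decomp_uniq (ecompP v). Qed.

Lemma ecomp_lin i : linear (fun v => ecomp v i).
Proof.
by move=> a u v; rewrite (ecomp_eq (eigen_decompD a (ecompP u) (ecompP v))).
Qed.

Lemma ecomp_eig v i : T v = ev i *: v ->
  ecomp v = fun j => if j == i then v else 0.
Proof. by move=> /eigen_decomp_eig/ecomp_eq. Qed.

Lemma ecomp_comm (S : V -> V) v i : linear S -> (forall u, T (S u) = S (T u)) ->
  ecomp (S v) i = S (ecomp v i).
Proof.
move=> lS TS; have [fp Tp vE] := ecompP v.
rewrite (@ecomp_eq _ (fun i => S (ecomp v i))) //; split.
- by apply: sub_finite_set fp => j /=; apply: contra => /eqP->; rewrite lin0.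
- by move=> j; rewrite TS Tp (linZ lS).
- by rewrite [in LHS]vE (fsum_lin lS) //; exact: finsuppT.
Qed.

End EigenDecomposition.

Section Bihomogeneous.
Variables (R : realType) (V : lmodType R[i]) (I J : choiceType).
Variables (ev : I -> R[i]) (ev' : J -> R[i]) (T S : V -> V).
Hypotheses (ev_inj : injective ev) (ev'_inj : injective ev').
Hypotheses (T_lin : linear T) (S_lin : linear S).
Hypotheses (T_ss : semisimple ev T) (S_ss : semisimple ev' S).
Hypothesis TS : forall u, T (S u) = S (T u).

(** [T] commutes with taking [S]-components, so the [S]-components of a [T]-eigenvector are again
    [T]-eigenvectors. *)
Lemma bihom_ind (P : V -> Prop) : P 0 -> (forall u v, P u -> P v -> P (u + v)) ->
  (forall i j v, T v = ev i *: v -> S v = ev' j *: v -> P v) -> forall v, P v.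
Proof.
move=> P0 PD Pe; apply: (eigen_ind T_ss) => // i v Tv.
have [fp Sp ->] := ecompP S_ss v.
rewrite (fsum_seq fp) //; last by move=> j _ /negP; rewrite negbK => /eqP.
apply: big_ind => // j _; apply: (Pe i j) => //.
rewrite -(ecomp_comm ev'_inj S_lin S_ss) // Tv.
exact: (linZ (ecomp_lin ev'_inj S_lin S_ss j)).
Qed.

End Bihomogeneous.

Section FamilySums.
Variables (R : realType) (U V : lmodType R[i]) (I : choiceType).
Variables (A : set I) (F : I -> U -> V).
Hypothesis F_lin : forall i, linear (F i).

Lemma fam_finsuppD u v : finsupp A (F^~ u) -> finsupp A (F^~ v) ->
  finsupp A (F^~ (u + v)).
Proof.
move=> fu fv; rewrite (_ : F^~ (u + v) = fun i => F i u + F i v).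
  exact: finsuppD.
by apply/funext => i; rewrite linD.
Qed.

Lemma fam_finsupp0 : finsupp A (F^~ 0).
Proof. by apply: sub_finite_set (finite_set0 I) => i [_]; rewrite lin0. Qed.

Lemma fam_sum_lin : (forall u, finsupp A (F^~ u)) ->
  linear (fun u => \sum_(i \in A) F i u).
Proof.
move=> fF a u v; rewrite -fsumZ // -fsumD //.
  by apply: eq_fsbigr => i _; rewrite F_lin.
by apply: sub_finite_set (fF u) => i [Ai ne]; split=> // F0; apply: ne; rewrite F0 scaler0.
Qed.

End FamilySums.

(** * Binomial coefficients and series of operators *)

Lemma sum_triangle (M : zmodType) (n : nat) (F : nat -> nat -> M) :
  \sum_(i < n.+1) \sum_(j < (n - i).+1) F i j
  = \sum_(s < n.+1) \sum_(i < s.+1) F i (s - i)%N.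
Proof.
elim: n => [|n IH]; first by rewrite !big_ord1.
rewrite [RHS]big_ord_recr -IH big_ord_recr /= subnn big_ord1.
rewrite [X in _ = _ + X]big_ord_recr /= subnn addrA; congr (_ + _).
rewrite -big_split; apply: eq_bigr => i _ /=.
by rewrite subSn -1?ltnS // big_ord_recr.
Qed.

Lemma sum_revn (M : zmodType) (n : nat) (F : nat -> M) :
  \sum_(i < n.+1) F i = \sum_(i < n.+1) F (n - i)%N.
Proof.
rewrite (reindex_inj rev_ord_inj); apply: eq_bigr => i _ /=.
by rewrite subSS.
Qed.

Section Gbinom.
Variable R : realType.
Implicit Types (a b : rat) (i n : nat).
Local Notation gb := (gbinom R).

Lemma gbinom0 a : gb a 0 = 1.
Proof. by rewrite /gbinom big_ord0 fact0 invr1 mulr1 rmorph1. Qed.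

Lemma gbinomS a i : i.+1%:R * gb a i.+1 = (ratr a - i%:R) * gb a i.
Proof.
rewrite /gbinom -[i.+1%:R](ratr_nat R[i]) -[i%:R](ratr_nat R[i]) -rmorphB -!rmorphM.
congr ratr; rewrite big_ord_recr /= factS natrM.
have fi : (i`!%:R : rat) != 0 by rewrite pnatr_eq0 -lt0n fact_gt0.
have Si : (i.+1%:R : rat) != 0 by rewrite pnatr_eq0.
by move: (i.+1%:R) (i`!%:R) Si fi => x y x0 y0; field; apply/andP.
Qed.

Lemma natmul_inj (K : numFieldType) n (x y : K) : n.+1%:R * x = n.+1%:R * y -> x = y.
Proof. by apply: mulfI; rewrite pnatr_eq0. Qed.

(** In characteristic 0 this recursion determines the sequence; [gbinom_nat], [gbinom_opp] and
    [gbinom_vandermonde] are proved by checking it. *)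
Lemma gbinom_eq a (f : nat -> R[i]) : f 0%N = 1 ->
  (forall i, i.+1%:R * f i.+1 = (ratr a - i%:R) * f i) -> forall i, gb a i = f i.
Proof.
move=> f0 fS; elim=> [|i IH]; first by rewrite gbinom0.
by apply: (@natmul_inj _ i); rewrite gbinomS fS IH.
Qed.

Lemma gbinom_nat n i : gb n%:R i = 'C(n, i)%:R.
Proof.
apply: (@gbinom_eq _ (fun i => 'C(n, i)%:R)) => [|{}i]; first by rewrite bin0.
rewrite ratr_nat -natrM mul_bin_left natrM.
have [lin|] := leqP i n; first by rewrite natrB.
by move=> lt; rewrite bin_small // !mulr0.
Qed.

Lemma gbinom_opp n j : gb (- n.+1%:R) j = (-1) ^+ j * 'C(n + j, j)%:R.
Proof.
apply: (@gbinom_eq _ (fun j => (-1) ^+ j * 'C(n + j, j)%:R)) => [|{}j].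
  by rewrite bin0 mulr1.
rewrite mulrCA -natrM addnS -mul_bin_diag natrM exprS.
rewrite rmorphN /= ratr_nat -addSn natrD; ring.
Qed.

Lemma gbinom_absorb a i : (ratr a - i%:R) * gb a i = ratr a * gb (a - 1) i.
Proof.
elim: i => [|i IH]; first by rewrite !gbinom0 subr0.
apply: (@natmul_inj _ i); rewrite mulrCA gbinomS IH !(mulrCA _ (ratr a)).
congr (_ * _); rewrite gbinomS rmorphB rmorph1 -natr1 /=; ring.
Qed.

Lemma gbinom_vandermonde a b n :
  \sum_(i < n.+1) gb a i * gb b (n - i)%N = gb (a + b) n.
Proof.
apply/esym/(@gbinom_eq _ (fun n => \sum_(i < n.+1) gb a i * gb b (n - i)%N)).
  by rewrite big_ord1 !gbinom0 mulr1.
move=> {}n.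
(* Leibniz rule for the product of (1+x)^a and (1+x)^b: the factor n+1 is split as i + (n+1-i). *)
have -> : n.+1%:R * (\sum_(i < n.+2) gb a i * gb b (n.+1 - i)%N)
  = \sum_(i < n.+2) (i%:R * gb a i) * gb b (n.+1 - i)%N
    + \sum_(i < n.+2) gb a i * ((n.+1 - i)%:R * gb b (n.+1 - i)%N).
  rewrite mulr_sumr -big_split; apply: eq_bigr => i _ /=.
  have : n.+1%:R = i%:R + (n.+1 - i)%:R :> R[i].
    by rewrite -natrD subnKC // -ltnS.
  by move=> ->; ring.
rewrite big_ord_recl /= mul0r mul0r add0r [X in _ + X]big_ord_recr /= subnn mul0r mulr0 addr0.
rewrite -big_split mulr_sumr; apply: eq_bigr => i _ /=.
rewrite subSS subSn -1?ltnS // !gbinomS rmorphD natrB /=; first by ring.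
by rewrite -ltnS.
Qed.

Lemma gbinom_0l i : gb 0 i = (i == 0)%:R.
Proof. by rewrite -[0]/(0%:R) gbinom_nat bin0n. Qed.

End Gbinom.

Section OperatorSeries.
Variables (K : numFieldType) (V : lmodType K).
Implicit Types (A B C H : nat -> V -> V) (z : nat -> V).

Local Notation opmul A B := (fun n v => \sum_(i < n.+1) A i (B (n - i)%N v)).

Lemma opmulA A B C n v : (forall i, linear (A i)) ->
  opmul (opmul A B) C n v = opmul A (opmul B C) n v.
Proof.
move=> lA /=; pose F i j := A i (B j (C (n - i - j)%N v)).
transitivity (\sum_(s < n.+1) \sum_(i < s.+1) F i (s - i)%N).
  apply: eq_bigr => s _; apply: eq_bigr => i _; rewrite /F.
  by have -> : (n - i - (s - i) = n - s)%N by have := ltn_ord i; lia.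
by rewrite -sum_triangle; apply: eq_bigr => i _; rewrite (lin_sum (lA i)).
Qed.

(** Coefficient form of uniqueness for x Z' = H(x) Z. As [H 0] vanishes, the right-hand side
    involves only earlier coefficients, and n is invertible for n > 0. *)
Lemma ode_uniq H z z' : (forall v, H 0%N v = 0) ->
  (forall n, n%:R *: z n = \sum_(k < n.+1) H k (z (n - k)%N)) ->
  (forall n, n%:R *: z' n = \sum_(k < n.+1) H k (z' (n - k)%N)) ->
  z 0%N = z' 0%N -> forall n, z n = z' n.
Proof.
move=> H0 zE z'E z0; elim/ltn_ind => -[//|n] IH.
apply: (scalerI (a := n.+1%:R)); first by rewrite pnatr_eq0.
rewrite zE z'E big_ord_recl [RHS]big_ord_recl !H0 !add0r; apply: eq_bigr => i _.
by rewrite IH // /= subSS ltnS leq_subr.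
Qed.

(** Leibniz rule for x d/dx, which multiplies the n-th coefficient by n. *)
Lemma opmul_deriv A B n v : (forall i, linear (A i)) ->
  n%:R *: opmul A B n v
  = opmul (fun i u => i%:R *: A i u) B n v + opmul A (fun i u => i%:R *: B i u) n v.
Proof.
move=> lA /=; rewrite scaler_sumr -big_split; apply: eq_bigr => i _ /=.
rewrite (linZ (lA i)) -scalerDl -natrD subnKC //.
by rewrite -ltnS.
Qed.

End OperatorSeries.

(** * Exponentials of series of commuting operators *)

Section OperatorExp.
Variables (R : realType) (V : lmodType R[i]) (A : nat -> V -> V).
Hypotheses (A_lin : forall i, linear (A i)) (A0 : forall v, A 0%N v = 0).
Hypothesis A_comm : forall i j v, A i (A j v) = A j (A i v).
Let P m := iter m (opser_mul A) (@opser_one _ V).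
Let dA i (u : V) := i%:R *: A i u.

Lemma opser_powS m n v :
  P m.+1 n v = \sum_(i < n.+1) A i (P m (n - i)%N v).
Proof. by []. Qed.

Lemma opser_pow_lin m n : linear (P m n).
Proof.
elim: m n => [|m IH] n; first by move=> a u v; rewrite /P /= /opser_one; case: eqP; rewrite ?scaler0 ?addr0.
by apply: lin_bigsum => i; apply: (lin_comp (IH _) (A_lin _)).
Qed.

Lemma opser_pow_small m n v : (n < m)%N -> P m n v = 0.
Proof.
elim: m n => // m IH n nm; rewrite opser_powS.
apply: big1 => -[[|i] /= Hi] _; first exact: A0.
by rewrite IH ?lin0 //; lia.
Qed.

(** The rule x (A^(m+1))' = (m+1) (x A') A^m. It needs the coefficients of A to commute: Leibniz
    leaves a factor A in front of x A', which has to be moved past it. *)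
Lemma opser_pow_deriv m n v :
  n%:R *: P m.+1 n v = m.+1%:R *: \sum_(k < n.+1) dA k (P m (n - k)%N v).
Proof.
elim: m n v => [|m IH] n v.
  rewrite /P /= /opser_mul scaler_sumr [RHS]scaler_sumr; apply: eq_bigr => i _.
  rewrite scale1r /dA /opser_one; case: eqP => [ni|]; last by rewrite lin0 // !scaler0.
  congr (_%:R *: _).
  by have := ltn_ord i; lia.
rewrite [LHS](opmul_deriv (P m.+1)) // -[in RHS]natr1 scalerDl scale1r addrC.
congr (_ + _).
under eq_bigr do rewrite IH (linZ (A_lin _)).
rewrite -scaler_sumr; congr (_ *: _).
have A_dA i j u : A i (dA j u) = dA j (A i u) by rewrite /dA (linZ (A_lin i)) A_comm.
have dA_lin i : linear (dA i) by exact: linZl.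
rewrite -(@opmulA _ _ A dA (P m)) // -(@opmulA _ _ dA A (P m)) //.
apply: eq_bigr => s _ /=; rewrite (sum_revn s (fun i => A i (dA (s - i)%N _))); apply: eq_bigr => i _.
by rewrite subKn ?A_dA // -ltnS.
Qed.

Lemma opser_exp_lin n : linear (opser_exp A n).
Proof. by apply: lin_bigsum => m; apply: linZl; exact: opser_pow_lin. Qed.

(** As [A 0] vanishes, A^m has no term below degree m. A range common to all degrees lets the sum
    over powers be exchanged with the sum over degrees. *)
Lemma opser_exp_widen N n v : (n < N)%N ->
  opser_exp A n v = \sum_(m < N) (m`!%:R)^-1 *: P m n v.
Proof.
move=> nN; rewrite /opser_exp (big_ord_widen N (fun m => (m`!%:R)^-1 *: P m n v)) //.
rewrite big_mkcond; apply: eq_bigr => m _; case: ifPn => //.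
by rewrite ltnS -ltnNge => /opser_pow_small->; rewrite scaler0.
Qed.

Lemma opser_exp0 v : opser_exp A 0 v = v.
Proof. by rewrite /opser_exp big_ord1 /= fact0 invr1 scale1r. Qed.

Lemma opser_exp_deriv n v :
  n%:R *: opser_exp A n v = \sum_(k < n.+1) dA k (opser_exp A (n - k)%N v).
Proof.
rewrite (@opser_exp_widen n.+2) ?scaler_sumr // big_ord_recl /=.
have -> : n%:R *: ((0`!%:R)^-1 *: P 0 n v) = 0.
  by rewrite /P /= /opser_one; case: eqP => [->|]; rewrite ?scale0r ?scaler0.
rewrite add0r; under eq_bigr => m _.
  rewrite scalerA mulrC -scalerA opser_pow_deriv scalerA factS natrM invfM /bump /=.
  rewrite mulrAC mulVf ?pnatr_eq0 // mul1r.
  over.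
under [RHS]eq_bigr => k _.
  rewrite (@opser_exp_widen n.+1) ?ltnS ?leq_subr // /dA (lin_sum (A_lin _)).
  under eq_bigr do rewrite (linZ (A_lin _)).
  rewrite scaler_sumr.
  under eq_bigr do rewrite scalerA mulrC -scalerA.
  over.
rewrite exchange_big /=; apply: eq_bigr => m _.
by rewrite scaler_sumr.
Qed.

(** Both sides solve the recursion of [opser_exp_deriv] with the same initial term. *)
Lemma opser_exp_comm (S : V -> V) n v : linear S ->
  (forall i u, S (A i u) = A i (S u)) ->
  S (opser_exp A n v) = opser_exp A n (S v).
Proof.
move=> lS SA; apply: (@ode_uniq _ _ dA (fun n => S (opser_exp A n v))
  (fun n => opser_exp A n (S v))) => [u|{}n|{}n|].
- by rewrite /dA scale0r.
- rewrite -(linZ lS) opser_exp_deriv (lin_sum lS); apply: eq_bigr => i _.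
  by rewrite /dA (linZ lS) SA.
- exact: opser_exp_deriv.
- by rewrite !opser_exp0.
Qed.
End OperatorExp.

(** * The scalars e^(pi i q) *)

Section Expipi.
Variable R : realType.
Implicit Types (q r : rat) (n : nat).
Local Notation e := (expipi R).

Lemma expipiD q r : e (q + r) = e q * e r.
Proof.
by rewrite /expipi rmorphD mulrDr cosD sinD; congr Complex; rewrite addrC.
Qed.

Lemma expipi0 : e 0 = 1.
Proof. by rewrite /expipi rmorph0 mulr0 cos0 sin0. Qed.

Lemma expipi_neq0 q : e q != 0.
Proof.
apply/eqP => q0; have := expipiD q (- q).
by rewrite subrr expipi0 q0 mul0r => /eqP; rewrite oner_eq0.
Qed.

Lemma expipiN q : e (- q) = (e q)^-1.
Proof.
by apply: (mulfI (expipi_neq0 q)); rewrite -expipiD subrr expipi0 mulfV ?expipi_neq0.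
Qed.

Lemma expipiX q n : e q ^+ n = e (n%:R * q).
Proof.
elim: n => [|n IH]; first by rewrite mul0r expipi0.
by rewrite exprS IH -expipiD -natr1 mulrDl mul1r addrC.
Qed.

Lemma expipiXz q (n : int) : e q ^ n = e (n%:~R * q).
Proof.
case: n => n; first by rewrite -exprnP expipiX.
by rewrite NegzE -exprnN expipiX mulrNz mulNr expipiN.
Qed.

Lemma expipi_1 : e 1 = -1.
Proof. by rewrite /expipi rmorph1 mulr1 cospi sinpi; apply/eqP; rewrite eq_complex /= oppr0 !eqxx. Qed.

Lemma expipi_nat n : e n%:R = (-1) ^+ n.
Proof. by rewrite -[n%:R]mulr1 -expipiX expipi_1. Qed.

Lemma expipi_2int (n : int) : e (2 * n%:~R) = 1.
Proof. by rewrite mulrC -expipiXz expipi_nat expr2 mulrNN mulr1 exp1rz. Qed.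

(** The fractional part r of q satisfies cos(2 pi r) = 1, hence sin(pi r) = 0, whereas sin is
    positive on the open interval from 0 to pi. *)
Lemma expipi_eq1 q : e (2 * q) = 1 -> q \is a Num.int.
Proof.
move=> e1; have fq := floor_itv q; set r := q - (Num.floor q)%:~R.
have [r0 r1] : 0 <= r /\ r < 1.
  by rewrite /r; move: fq; rewrite intrD => /andP[? ?]; split; lra.
have er : e (2 * r) = 1.
  by rewrite /r mulrBr expipiD e1 mul1r expipiN expipi_2int invr1.
suff : r = 0 by move/eqP; rewrite subr_eq0 => /eqP->; exact: intr_int.
apply/eqP; rewrite eq_le r0 andbT leNgt; apply/negP => r_gt0.
have : sin (pi * ratr r) > 0 :> R.
  apply: sin_gt0_pi; rewrite mulr_gt0 ?pi_gt0 ?ltr0q //=.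
  by rewrite -[X in _ < X]mulr1 ltr_pM2l ?pi_gt0 // -(rmorph1 (@ratr R)) ltr_rat.
have /eqP := er; rewrite eq_complex /= => /andP[/eqP + _].
have -> : pi * ratr (2 * r) = (pi * ratr r : R) *+ 2.
  by rewrite rmorphM rmorph_nat /= -mulr_natr; ring.
rewrite cos_mulr2n cos2sin2 => c1 s_gt0.
by have : sin (pi * ratr r : R) ^+ 2 > 0 by [exact: exprn_gt0]; move: c1; lra.
Qed.

End Expipi.

(** * The series Delta(h,z) on a vertex operator algebra *)

Section Commutator.
Variables (R : realType) (V W : lmodType R[i]).
Variables (Y : V -> int -> V -> V) (vac : V) (YW : V -> int -> W -> W).
Hypothesis M : va_module Y vac YW.

(** The Jacobi identity at l = 0, where only the terms i = 0 survive on the left. *)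
Lemma commutator u v w (m n : int) :
  YW u m (YW v n w) - YW v n (YW u m w)
  = \sum_(i \in [set: nat]) gbinom R m%:~R i *: YW (Y u i%:Z v) (m + n - i%:Z) w.
Proof.
have := vam_jacobi M u v w 0 m n.
rewrite [X in X - _](@fsum_ord _ _ 1) => [|[//|i] _]; last first.
  by rewrite gbinom_0l mulr0 scale0r.
rewrite [X in _ - X](@fsum_ord _ _ 1) => [|[//|i] _]; last first.
  by rewrite gbinom_0l mulr0 scale0r.
rewrite !big_ord1 /=.
rewrite !gbinom0 !(addr0, add0r, subr0) expr0z expr0 mul1r !scale1r => ->.
by apply: eq_fsbigr => i _; rewrite add0r.
Qed.

Lemma commutator_nat u v w (m : nat) (n : int) :
  YW u m%:Z (YW v n w) - YW v n (YW u m%:Z w)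
  = \sum_(i < m.+1) 'C(m, i)%:R *: YW (Y u i%:Z v) (m%:Z + n - i%:Z) w.
Proof.
rewrite commutator (@fsum_ord _ _ m.+1) => [|i mi].
  by apply: eq_bigr => i _; rewrite gbinom_nat.
by rewrite gbinom_nat bin_small // scale0r.
Qed.

End Commutator.

(** [Delta] without its factor z^(h(0)). This part involves only integral powers of z and preserves
    the eigenspaces of h(0), so fractional exponents can be put back at the end. *)
Definition Delta_ser (R : realType) (V : lmodType R[i]) (Y : V -> int -> V -> V) (h : V) :=
  opser_exp (fun n u =>
    if n == 0%N then 0 else ((-1) ^+ n / - n%:R) *: Y h n%:Z u).

Section VOA.
Variables (R : realType) (V : lmodType R[i]).
Variables (Y : V -> int -> V -> V) (vac omega h : V) (gamma : rat).
Hypothesis HV : voa Y vac omega.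
Hypothesis Lh : forall n : nat, Lop Y omega n%:Z h = if n == 0%N then h else 0.
Hypothesis hh : forall n : nat, Y h n%:Z h = if n == 1%N then ratr gamma *: vac else 0.
Hypothesis h_ss : semisimple ratr (Y h 0).

Let M : va_module Y vac Y := va_self (voa_va HV).
Let Yl n w := vam_linl M n w.
Let Yr v n := vam_linr M v n.
Local Notation L0 := (Lop Y omega 0).
Local Notation L1 := (Lop Y omega 1).
Local Notation E := (Delta_ser Y h).

(** [h(m), h(n)] is m gamma times the mode m+n-1 of the vacuum, which is nonzero only for m+n = 0;
    with m, n >= 0 this forces the factor m to vanish. *)
Lemma h_comm (m n : nat) v : Y h m%:Z (Y h n%:Z v) = Y h n%:Z (Y h m%:Z v).
Proof.
apply/eqP; rewrite -subr_eq0; apply/eqP.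
rewrite (commutator_nat M); apply: big1 => i _; rewrite hh.
case: eqP => [->|_]; last by rewrite (lin0 (Yl _ _)) scaler0.
rewrite (linZ (Yl _ _)) (vam_vac M) bin1.
case: eqP => [mn|_]; last by rewrite !scaler0.
have m0 : m = 0%N by lia.
by rewrite m0 mulr0n scale0r.
Qed.

Lemma h0_deriv u p v : Y h 0 (Y u p v) = Y (Y h 0 u) p v + Y u p (Y h 0 v).
Proof.
have /eqP := commutator_nat M h u v 0 p; rewrite big_ord1 bin0 scale1r.
by rewrite subr_eq add0r subr0 => /eqP.
Qed.

(** Only L(-1)h and L(0)h = h contribute to the commutator, with coefficients -(m+n+1) and m+1. *)
Lemma omega_h (m n : nat) v :
  Lop Y omega m%:Z (Y h n%:Z v) = Y h n%:Z (Lop Y omega m%:Z v) - n%:R *: Y h (m + n)%N%:Z v.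
Proof.
have o1 : Y omega 1 h = h by have := Lh 0.
have oS i : Y omega i.+2%:Z h = 0.
  by have := Lh i.+1; rewrite /Lop (_ : i.+1%:Z + 1 = i.+2) //; lia.
have /eqP := commutator_nat M omega h v m.+1 n%:Z.
rewrite subr_eq /Lop -addn1 PoszD => /eqP->; rewrite addrC; congr (_ + _).
rewrite addn1 big_ord_recl big_ord_recl /= big1 ?addr0 => [|i _]; last first.
  by rewrite /bump /= !add1n oS (lin0 (Yl _ _)) scaler0.
have := voa_deriv HV h (m.+1 + n)%N%:Z v; rewrite /Lop addNr => oE.
rewrite /bump /= bin0 bin1 scale1r o1.
rewrite (_ : m%:Z + 1 + n = (m.+1 + n)%N) ?oE; last by lia.
have -> : (m.+1 + n)%N%:Z - 1 = (m + n)%N by lia.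
rewrite -scalerDl -scaleNr; congr (_ *: _).
by rewrite -pmulrn natrD; ring.
Qed.

Lemma L0L1 v : L0 (L1 v) = L1 (L0 v) - L1 v.
Proof.
have [c Hc] := voa_virasoro HV; have /eqP := Hc 0 1 v.
by rewrite add0r /= addr0 subr_eq mulrN1z scaleN1r add0r addrC => /eqP.
Qed.

(** The coefficients of the differential equation of the overview after multiplication by x. They
    are k times the coefficients [Delta_A k] of the exponent. *)
Let H (k : nat) (v : V) : V := if k == 0%N then 0 else (-1) ^+ k.+1 *: Y h k%:Z v.

Let Delta_A (n : nat) (u : V) : V :=
  if n == 0%N then 0 else ((-1) ^+ n / - n%:R) *: Y h n%:Z u.

Let Delta_A_lin n : linear (Delta_A n).
Proof.
rewrite /Delta_A; case: eqP => _; last exact: linZl.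
by move=> a u v; rewrite scaler0 addr0.
Qed.

Let Delta_A_comm (S : V -> V) : linear S ->
  (forall n u, S (Y h n%:Z u) = Y h n%:Z (S u)) ->
  forall n u, S (Delta_A n u) = Delta_A n (S u).
Proof.
move=> lS SH n u; rewrite /Delta_A; case: eqP => _; first exact: lin0.
by rewrite (linZ lS) SH.
Qed.

Let Delta_A_commA i j v : Delta_A i (Delta_A j v) = Delta_A j (Delta_A i v).
Proof.
apply: Delta_A_comm => // n u; apply/esym/Delta_A_comm => //.
by move=> m w; exact: h_comm.
Qed.

Lemma Delta_ser_lin n : linear (E n).
Proof. exact: opser_exp_lin. Qed.

Lemma Delta_ser0 v : E 0 v = v.
Proof. exact: opser_exp0. Qed.

Lemma Delta_ser_ode n v : n%:R *: E n v = \sum_(k < n.+1) H k (E (n - k)%N v).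
Proof.
rewrite opser_exp_deriv //; apply: eq_bigr => k _; rewrite /H.
case: (val k =P 0%N) => [->|/eqP k0]; first by rewrite scaler0.
rewrite scalerA; congr (_ *: _); rewrite exprS.
by rewrite invrN mulrCA mulrN mulfV ?pnatr_eq0 // mulN1r mulrN1.
Qed.

Lemma Delta_ser_comm (S : V -> V) : linear S ->
  (forall n u, S (Y h n%:Z u) = Y h n%:Z (S u)) ->
  forall n u, S (E n u) = E n (S u).
Proof. by move=> lS SH n u; apply: opser_exp_comm => //; exact: Delta_A_comm. Qed.

Lemma Delta_ser_hcomm k n v : Y h k%:Z (E n v) = E n (Y h k%:Z v).
Proof. by apply: Delta_ser_comm => // m u; exact: h_comm. Qed.

Lemma Delta_ser_vac n : E n vac = if n == 0%N then vac else 0.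
Proof.
case: n => [|n]; first exact: Delta_ser0.
elim/ltn_ind: n => n IH; apply: (scalerI (a := n.+1%:R)); first by rewrite pnatr_eq0.
rewrite Delta_ser_ode scaler0; apply: big1 => k _; rewrite /H.
case: eqP => // _; rewrite Delta_ser_hcomm.
by rewrite (va_creation (voa_va HV)) (lin0 (Delta_ser_lin _)) scaler0.
Qed.

Lemma Delta_ser_weight (d : R[i]) n v : L0 v = d *: v ->
  L0 (E n v) = (d - n%:R) *: E n v.
Proof.
move=> Lv; elim/ltn_ind: n => -[_|n IH]; first by rewrite Delta_ser0 subr0.
apply: (scalerI (a := n.+1%:R)); first by rewrite pnatr_eq0.
rewrite scalerA mulrC -scalerA Delta_ser_ode -(linZ (Yr _ _)) Delta_ser_ode.
rewrite (lin_sum (Yr _ _)) scaler_sumr; apply: eq_bigr => k _; rewrite /H.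
case: eqP => [_|/eqP k0]; first by rewrite (lin0 (Yr _ _)) scaler0.
rewrite (linZ (Yr _ _)) scalerA mulrC -scalerA; congr (_ *: _).
rewrite -/(Lop Y omega 0%N%:Z _) omega_h IH; last by have := ltn_ord k; lia.
rewrite (linZ (Yr _ _)) add0n -scalerBl; congr (_ *: _).
by rewrite natrB ?opprB; [ring | rewrite -ltnS].
Qed.

(** Weights on V are bounded below by some [N0], and [D n v] has weight d - n, which drops below
    [N0] for large n. This truncates [Delta_ser] as well as the iterates of L(1) and L~(1). *)
Lemma weight_lowering (D : nat -> V -> V) : (forall n, linear (D n)) ->
  (forall (d : R[i]) n v, L0 v = d *: v -> L0 (D n v) = (d - n%:R) *: D n v) ->
  forall v, exists N, forall n, (N <= n)%N -> D n v = 0.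
Proof.
move=> lD wD; apply: (eigen_ind (voa_grading HV)).
- by exists 0%N => n _; rewrite lin0.
- move=> u v [N1 D1] [N2 D2]; exists (maxn N1 N2) => n; rewrite geq_max => /andP[n1 n2].
  by rewrite (linD (lD n)) D1 // D2 // addr0.
- move=> d v Lv; have [N0 HN0] := voa_trunc HV.
  exists (absz (d - N0 + 1)) => n dn; apply: (HN0 (d - n%:Z)); first by lia.
  by rewrite (wD _ _ _ Lv) intrD mulrNz -pmulrn.
Qed.

Lemma Delta_ser_trunc v : exists N, forall n, (N <= n)%N -> E n v = 0.
Proof. exact: weight_lowering Delta_ser_lin Delta_ser_weight v. Qed.

Let omega' := omega + 2^-1 *: Lop Y omega (-1) h.

(** The mode n+1 of L(-1)h is -(n+1) h(n). *)
Lemma Lop_shift (n : nat) v :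
  Lop Y omega' n%:Z v = Lop Y omega n%:Z v - (2^-1 * n.+1%:R) *: Y h n%:Z v.
Proof.
rewrite /Lop (linD (Yl _ _)) (linZ (Yl _ _)); congr (_ + _).
have := voa_deriv HV h (n%:Z + 1) v; rewrite /Lop => ->.
rewrite scalerA -scaleNr mulrN addrK; congr (- (_ * _) *: _).
by rewrite -addn1 pmulrn PoszD.
Qed.

(** * Factorization of Delta(h,z) through L(1) and L~(1) *)

Let L_lin n : linear (Lop Y omega n). Proof. exact: Yr. Qed.

(** [P] and [Q] are the coefficients of e^(xL(1)) and e^(xB), where B = h(1) - L(1) is -L~(1). *)
Let P i (v : V) := (i`!%:R)^-1 *: iter i L1 v.
Let B v := Y h 1 v - L1 v.
Let Q i (v : V) := (i`!%:R)^-1 *: iter i B v.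

Let fact_step (f : V -> V) i v :
  i.+1%:R *: ((i.+1`!%:R)^-1 *: iter i.+1 f v) = (i`!%:R)^-1 *: f (iter i f v).
Proof.
by rewrite scalerA factS natrM invfM mulrA mulfV ?mul1r // pnatr_eq0.
Qed.

Let B_lin : linear B.
Proof. by move=> a u v; rewrite /B /Lop !Yr scalerBr opprD addrACA. Qed.

Let P_lin i : linear (P i). Proof. by apply: linZl; apply: lin_iter; exact: Yr. Qed.
Let Q_lin i : linear (Q i). Proof. by apply: linZl; exact: lin_iter. Qed.

Let P_deriv i v : i.+1%:R *: P i.+1 v = P i (L1 v).
Proof. by rewrite /P fact_step -iterS iterSr. Qed.

Let P_deriv' i v : i.+1%:R *: P i.+1 v = L1 (P i v).
Proof. by rewrite /P fact_step (linZ (L_lin _)). Qed.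

Let Q_deriv i v : i.+1%:R *: Q i.+1 v = B (Q i v).
Proof. by rewrite /Q fact_step (linZ B_lin). Qed.

(** By [omega_h], (ad L(1))^k h(1) = (-1)^k k! h(k+1); this is the conjugate of h(1) by e^(xL(1)),
    read off in degree i. *)
Let P_h1 i v :
  P i (Y h 1 v) = \sum_(k < i.+1) (-1) ^+ k *: Y h k.+1%:Z (P (i - k)%N v).
Proof.
elim: i v => [|i IH] v; first by rewrite big_ord1 /P !fact0 invr1 !scale1r.
apply: (scalerI (a := i.+1%:R)); first by rewrite pnatr_eq0.
rewrite P_deriv' IH (lin_sum (L_lin _)).
under eq_bigr => k _.
  rewrite (linZ (L_lin _)) omega_h -P_deriv'.
  rewrite add1n (linZ (Yr _ _)) scalerBr; over.
rewrite sumrB scaler_sumr.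
(* Letting L(1) act on [P] produces the factor i+1-k; the commutator with h(k+1), after a shift of k
   by one, produces the factor k. They add up to i+1. *)
transitivity (\sum_(k < i.+2) ((i.+1 - k)%:R * (-1) ^+ k) *: Y h k.+1%:Z (P (i.+1 - k)%N v)
   + \sum_(k < i.+2) (k%:R * (-1) ^+ k) *: Y h k.+1%:Z (P (i.+1 - k)%N v)).
  rewrite [X in _ = X + _]big_ord_recr [X in _ = _ + X]big_ord_recl /=.
  rewrite subnn !mul0r !scale0r addr0 add0r -sumrN; congr (_ + _).
    apply: eq_bigr => k _; rewrite scalerA mulrC; congr (_ *: _); last first.
      by rewrite subSn // -ltnS.
    by rewrite subSn // -ltnS.
  apply: eq_bigr => k _; rewrite /bump /= !add1n subSS scalerA -scaleNr.
  by congr (_ *: _); rewrite exprS; ring.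
rewrite -big_split; apply: eq_bigr => k _ /=.
rewrite -scalerDl scalerA -mulrDl -natrD subnK //.
by rewrite -ltnS.
Qed.

(* Both sides satisfy n Z_n = \sum_(k > 0) (-1)^(k+1) h_k Z_(n-k); for the
   right-hand side this is d/dx e^(x L(1)) e^(x (h(1) - L(1)))
   = (e^(x L(1)) h(1) e^(-x L(1))) e^(x L(1)) e^(x (h(1) - L(1))). *)
Lemma Delta_ser_exp n v :
  E n v = \sum_(i < n.+1) (i`!%:R)^-1 *:
    iter i L1 (((n - i)`!%:R)^-1 *: iter (n - i) (fun u => Y h 1 u - L1 u) v).
Proof.
apply: (@ode_uniq _ _ H (fun n => E n v)
  (fun n => \sum_(i < n.+1) P i (Q (n - i)%N v))) => [//|{}n|{}n|].
- exact: Delta_ser_ode.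
- case: n => [|n]; first by rewrite !big_ord1 /= scale0r.
  rewrite (opmul_deriv Q n.+1 v P_lin) -(@opmulA _ _ H P Q); last first.
    move=> k; rewrite /H; case: eqP => _; last exact: linZl.
    by move=> a u w; rewrite scaler0 addr0.
  rewrite big_ord_recl scale0r add0r [X in _ + X]big_ord_recr /= subnn scale0r.
  rewrite (lin0 (P_lin _)) addr0 -big_split [RHS]big_ord_recl big_ord1 /= add0r.
  apply: eq_bigr => i _ /=.
  rewrite /bump /= !add1n subSS P_deriv subSn -1?ltnS // Q_deriv -(linD (P_lin i)).
  rewrite /B addrC subrK P_h1 [RHS]big_ord_recl /= add0r; apply: eq_bigr => k _.
  by rewrite /H /bump /= add1n subSS !exprS !mulN1r opprK.
- by rewrite Delta_ser0 big_ord1 /P /Q fact0 invr1 !scale1r.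
Qed.

Let H_lin k : linear (H k).
Proof.
rewrite /H; case: eqP => _; last exact: linZl.
by move=> a u w; rewrite scaler0 addr0.
Qed.

(** * Commutation of Delta(h,z) with vertex operators *)

Section Eigenvector.
Variables (lam : rat) (u : V).
Hypothesis u_lam : Y h 0 u = ratr lam *: u.
Local Notation gb := (gbinom R).

(** The coefficient of z^(lam-N) x^(-p-1) in Y(Delta(h,z+x)u, x)v, with (z+x)^(lam-a) expanded in
    nonnegative powers of x. *)
Let X p N (v : V) :=
  \sum_(a < N.+1) gb (lam - a%:R) (N - a)%N *: Y (E a u) (p + (N - a)%N%:Z) v.

Let X_lin p N : linear (X p N).
Proof. by apply: lin_bigsum => a; exact: linZl. Qed.

Lemma Delta_ser_eigen n : Y h 0 (E n u) = ratr lam *: E n u.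
Proof. by rewrite (Delta_ser_hcomm 0) u_lam (linZ (Delta_ser_lin _)). Qed.

(** The commutator formula gives the factor 'C(k, i); with k = i + j, the number (-1)^j 'C(i+j, j)
    is binom(-(i+1), j), and Vandermonde merges it with binom(lam-a, n-i-j). In generating series
    this is multiplication by (z+x)^(-i-1). *)
Let commutator_sum (a n : nat) (p : int) v :
  \sum_(k < n.+1) ((-1) ^+ k.+1 * gb (lam - a%:R) (n - k)%N) *:
     (Y h k%:Z (Y (E a u) (p + (n - k)%N%:Z) v)
      - Y (E a u) (p + (n - k)%N%:Z) (Y h k%:Z v))
  = \sum_(i < n.+1) ((-1) ^+ i.+1 * gb (lam - (a + i).+1%:R) (n - i)%N) *:
      Y (Y h i%:Z (E a u)) (p + (n - i)%N%:Z) v.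
Proof.
pose F i j := ((-1) ^+ (i + j).+1 * gb (lam - a%:R) (n - i - j)%N * 'C(i + j, j)%:R) *:
  Y (Y h i%:Z (E a u)) (p + (n - i)%N%:Z) v.
transitivity (\sum_(k < n.+1) \sum_(i < k.+1) F i (k - i)%N).
  apply: eq_bigr => k _; rewrite (commutator_nat M) scaler_sumr; apply: eq_bigr => i _.
  rewrite scalerA /F subnKC; last by rewrite -ltnS.
  have ik := ltn_ord i; have kn := ltn_ord k.
  rewrite bin_sub; last by rewrite -ltnS.
  rewrite (_ : n - i - (k - i) = n - k)%N; last by lia.
  by congr (_ *: Y _ _ _); lia.
rewrite -sum_triangle; apply: eq_bigr => i _; rewrite /F -scaler_suml; congr (_ *: _).
have -> : lam - (a + i).+1%:R = - i.+1%:R + (lam - a%:R).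
  by rewrite -addnS natrD; ring.
rewrite -gbinom_vandermonde mulr_sumr; apply: eq_bigr => j _.
by rewrite gbinom_opp -addSn exprD; ring.
Qed.

(** [H, X] is the derivative of X. Combined with the Leibniz rule, it shows that the product of [X]
    and [Delta_ser] solves the same equation as [Delta_ser]. *)
Let commutator_total N p v :
  \sum_(k < N.+1) (H k (X p (N - k)%N v) - X p (N - k)%N (H k v)) = N%:R *: X p N v.
Proof.
pose D k a := Y h k%:Z (Y (E a u) (p + (N - k - a)%N%:Z) v)
  - Y (E a u) (p + (N - k - a)%N%:Z) (Y h k%:Z v).
pose F k a := ((-1) ^+ k.+1 * gb (lam - a%:R) (N - k - a)%N) *: D k a.
pose G a i := ((-1) ^+ i.+1 * gb (lam - (a + i).+1%:R) (N - a - i)%N) *: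
      Y (Y h i%:Z (E a u)) (p + (N - a - i)%N%:Z) v.
have D0 a : D 0%N a = ratr lam *: Y (E a u) (p + (N - a)%N%:Z) v.
  by rewrite /D subn0 h0_deriv addrK Delta_ser_eigen (linZ (Yl _ _)).
(* [H] has no term k = 0, whereas [commutator_sum] includes it; there [h(0), -] acts on the modes of
   [E a u] as [lam], which is added back. *)
have -> : \sum_(k < N.+1) (H k (X p (N - k)%N v) - X p (N - k)%N (H k v))
    = \sum_(k < N.+1) \sum_(a < (N - k).+1) F k a + ratr lam *: X p N v.
  rewrite big_ord_recl [in RHS]big_ord_recl /= (lin0 (X_lin _ _)) subrr add0r.
  have -> : \sum_(a < (N - 0).+1) F 0%N a = - ratr lam *: X p N v.
    rewrite subn0 scaler_sumr; apply: eq_bigr => a _.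
    by rewrite /F D0 subn0 expr1 !scalerA; congr (_ *: _); ring.
  rewrite addrAC scaleNr addNr add0r; apply: eq_bigr => k _.
  rewrite /H /bump /= add1n (linZ (X_lin _ _)) -scalerBr.
  rewrite (lin_sum (Yr _ _)) -sumrB scaler_sumr; apply: eq_bigr => a _.
  by rewrite (linZ (Yr _ _)) -scalerBr scalerA.
have -> : \sum_(k < N.+1) \sum_(a < (N - k).+1) F k a
    = \sum_(a < N.+1) \sum_(i < (N - a).+1) G a i.
  transitivity (\sum_(a < N.+1) \sum_(k < (N - a).+1) F k a).
    rewrite sum_triangle (sum_triangle N (fun a k => F k a)); apply: eq_bigr => s _.
    rewrite (sum_revn s (fun k => F k (s - k)%N)); apply: eq_bigr => i _.
    by rewrite subKn // -ltnS.
  apply: eq_bigr => a _; rewrite -commutator_sum; apply: eq_bigr => k _.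
  by rewrite /F /D subnAC.
rewrite sum_triangle.
(* For fixed b = a + i, the recursion of [Delta_ser] together with its extra term -h(0) gives (b -
   lam) E_b u; [gbinom_absorb] then trades b - lam for N - lam while restoring the binomial of
   [X]. *)
have -> : \sum_(s < N.+1) \sum_(i < s.+1) G i (s - i)%N = (N%:R - ratr lam) *: X p N v.
  rewrite scaler_sumr; apply: eq_bigr => b _.
  have bN : (b <= N)%N by rewrite -ltnS.
  transitivity (gb (lam - b.+1%:R) (N - b)%N *:
    Y (\sum_(i < b.+1) (-1) ^+ i.+1 *: Y h i%:Z (E (b - i)%N u)) (p + (N - b)%N) v).
    rewrite (lin_sum (Yl _ _)) scaler_sumr (sum_revn b (fun i => G i (b - i)%N)); apply: eq_bigr => i _.
    rewrite /G (linZ (Yl _ _)) scalerA mulrC.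
    have ib := ltn_ord i.
    rewrite subKn; last by lia.
    rewrite subnK; last by lia.
    by rewrite (_ : N - (b - i) - i = N - b)%N //; lia.
  have -> : \sum_(i < b.+1) (-1) ^+ i.+1 *: Y h i%:Z (E (b - i)%N u)
      = (b%:R - ratr lam) *: E b u.
    rewrite scalerBl Delta_ser_ode !big_ord_recl /= add0r subn0 expr1 scaleN1r.
    rewrite Delta_ser_eigen addrC; congr (_ - _).
  rewrite (linZ (Yl _ _)) !scalerA; congr (_ *: _).
  have := gbinom_absorb R (lam - b%:R) (N - b)%N.
  rewrite natrB // rmorphB /= ratr_nat.
  have -> : lam - b%:R - 1 = lam - b.+1%:R by rewrite -[in RHS]natr1; ring.
  set g := gb _ _; set g' := gb _ _ => gg.
  transitivity (- ((ratr lam - b%:R) * g')); first by ring.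
  by rewrite -gg; ring.
by rewrite -scalerDl subrK.
Qed.

(* The coefficient of z^(-c) x^(-p-1) in the conjugation formula
   z^(-h(0)) Delta(h,z) Y(u,x) v
     = z^(-h(0)) Y(Delta(h,z+x) u, x) Delta(h,z) v. *)
Lemma Delta_ser_vertex c p v :
  E c (Y u p v) = \sum_(s < c.+1) \sum_(a < s.+1)
    gb (lam - a%:R) (s - a)%N *: Y (E a u) (p + (s - a)%N%:Z) (E (c - s)%N v).
Proof.
apply: (@ode_uniq _ _ H (fun c => E c (Y u p v))
  (fun c => \sum_(s < c.+1) X p s (E (c - s)%N v))) => [//|{}c|{}c|].
- exact: Delta_ser_ode.
- rewrite (opmul_deriv _ c v (X_lin p)) -(@opmulA _ _ H (X p) E c v H_lin).
  have -> : \sum_(i < c.+1) X p i ((c - i)%:R *: E (c - i)%N v)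
     = \sum_(s < c.+1) \sum_(i < s.+1) X p i (H (s - i)%N (E (c - s)%N v)).
    rewrite (@opmulA _ _ (X p) H E c v (X_lin p)); apply: eq_bigr => i _.
    by rewrite Delta_ser_ode.
  rewrite -big_split; apply: eq_bigr => s _ /=.
  rewrite -commutator_total sumrB [X in _ - X](sum_revn s (fun i => X p (s - i)%N (H i (E (c - s)%N v)))).
  rewrite [X in _ - X](eq_bigr (fun i : 'I_s.+1 => X p i (H (s - i)%N (E (c - s)%N v)))).
    by rewrite subrK.
  by move=> i _; rewrite subKn // -ltnS.
- rewrite Delta_ser0 big_ord1 /X big_ord1 !Delta_ser0 gbinom0 scale1r.
  by rewrite addr0.
Qed.

End Eigenvector.

End VOA.

(** * The twisted module defined by Delta(h,z) *)

Lemma fsum_one (M : zmodType) (I : choiceType) (A : set I) (F : I -> M) i : A i ->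
  (forall j, A j -> j <> i -> F j = 0) -> \sum_(j \in A) F j = F i.
Proof.
move=> Ai F0; rewrite -(@fsbig_widen _ _ _ _ [set i]) ?fsbig_set1 //.
  by move=> _ ->.
by move=> j [Aj ji]; exact: F0.
Qed.

Lemma sum_trunc (M : zmodType) (F : nat -> M) N C : (N <= C)%N ->
  (forall i, (N <= i < C)%N -> F i = 0) -> \sum_(i < C) F i = \sum_(i < N) F i.
Proof.
move=> NC F0; rewrite (big_ord_widen C F NC) [RHS]big_mkcond; apply: eq_bigr => i _.
by case: ltnP => // Ni; rewrite F0 // Ni ltn_ord.
Qed.

(** Terms outside the box vanish, and the triangle s + b < C contains the whole box once C >= N1 +
    N2. *)
Lemma sum_box (M : zmodType) (G : nat -> nat -> M) N1 N2 C : (N1 + N2 <= C)%N ->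
  (forall s b, (N1 <= s)%N || (N2 <= b)%N -> G s b = 0) ->
  \sum_(c < C) \sum_(s < c.+1) G s (c - s)%N = \sum_(s < N1) \sum_(b < N2) G s b.
Proof.
case: C => [|C] NC G0.
  by have N10 : N1 = 0%N by [lia]; rewrite N10 !big_ord0.
rewrite -sum_triangle (@sum_trunc _ (fun s => \sum_(b < (C - s).+1) G s b) N1).
- apply: eq_bigr => s _; have sN := ltn_ord s; apply: sum_trunc; first by lia.
  by move=> b /andP[N2b _]; rewrite G0 // N2b orbT.
- by lia.
- by move=> s /andP[N1s _]; apply: big1 => b _; rewrite G0 // N1s.
Qed.

Lemma bound_uniform (P : nat -> nat -> Prop) N :
  (forall a, exists T, forall t, (T <= t)%N -> P a t) ->
  exists T, forall a t, (a < N)%N -> (T <= t)%N -> P a t.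
Proof.
move=> HP; elim: N => [|N [T HT]]; first by exists 0%N.
have [T' HT'] := HP N; exists (maxn T T') => a t; rewrite ltnS leq_eqVlt geq_max.
by move=> /orP[/eqP->|aN] /andP[Tt T't]; [exact: HT' | exact: HT].
Qed.

Lemma ratr_inj (R : realType) : injective (ratr : rat -> R[i]).
Proof. exact: fmorph_inj. Qed.

Section ExpipiOp.
Variables (R : realType) (V : lmodType R[i]) (T : V -> V).
Hypotheses (T_lin : linear T) (T_ss : semisimple ratr T).

Lemma eigen_comp_lin q : linear (fun v => eigen_comp T v q).
Proof. exact: (ecomp_lin (@ratr_inj R) T_lin T_ss q). Qed.

Lemma eigen_comp_eig v q : T v = ratr q *: v ->
  eigen_comp T v = fun q' => if q' == q then v else 0.
Proof. by move=> Tv; exact: (ecomp_eig (@ratr_inj R) T_lin T_ss). Qed.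

Lemma expipi_op_eig c v q : T v = ratr q *: v ->
  expipi_op T c v = expipi R (c * q) *: v.
Proof.
move=> Tv; rewrite /expipi_op (eigen_comp_eig Tv).
rewrite (@fsum_one _ _ _ _ q) ?eqxx // => j _ /eqP/negbTE->.
by rewrite scaler0.
Qed.

Lemma eigen_comp_finsupp v : finite_set [set q | eigen_comp T v q <> 0].
Proof.
by have [+ _ _] := ecompP T_ss v; apply: sub_finite_set => q /= /eqP.
Qed.

Lemma expipi_op_lin c : linear (expipi_op T c).
Proof.
apply: (@fam_sum_lin _ _ _ _ _ (fun q v => expipi R (c * q) *: eigen_comp T v q)).
  by move=> q; apply: linZl; exact: eigen_comp_lin.
move=> v; apply: sub_finite_set (eigen_comp_finsupp v) => q [_ ne] q0; apply: ne.
by rewrite q0 scaler0.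
Qed.

End ExpipiOp.

Section Twisted.
Variables (R : realType) (V : lmodType R[i]).
Variables (Y : V -> int -> V -> V) (vac omega h : V) (gamma : rat).
Hypothesis HV : voa Y vac omega.
Hypothesis Lh : forall n : nat, Lop Y omega n%:Z h = if n == 0%N then h else 0.
Hypothesis hh : forall n : nat, Y h n%:Z h = if n == 1%N then ratr gamma *: vac else 0.
Hypothesis h_ss : semisimple ratr (Y h 0).
Variables (W : lmodType R[i]) (YW : V -> int -> W -> W).
Hypothesis MW : va_module Y vac YW.

Let M : va_module Y vac Y := va_self (voa_va HV).
Let Yl n w := vam_linl M n w.
Let Yr v n := vam_linr M v n.
Let YWl n w := vam_linl MW n w.
Let YWr v n := vam_linr MW v n.
Local Notation h0 := (Y h 0).
Local Notation E := (Delta_ser Y h).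
Local Notation gb := (gbinom R).
Let E_lin n : linear (E n). Proof. exact: (Delta_ser_lin h HV). Qed.

Lemma Delta_finsupp s v : finsupp [set x : rat * nat | x.1 - x.2%:R = s]
  (fun x => eigen_comp h0 (E x.2 v) x.1).
Proof.
move: v; apply: (eigen_ind h_ss) => [|u v fu fv|q v hv].
- apply: (fam_finsupp0 _ (F := fun x v => eigen_comp h0 (E x.2 v) x.1)) => x.
  exact: lin_comp (E_lin _) (eigen_comp_lin (Yr _ _) h_ss _).
- apply: (fam_finsuppD _ (F := fun x v => eigen_comp h0 (E x.2 v) x.1)) => // x.
  exact: lin_comp (E_lin _) (eigen_comp_lin (Yr _ _) h_ss _).
(* On the q-eigenspace, n = q - s is the only index that contributes. *)
- apply: sub_finite_set (finite_set1 (q, Num.truncn (q - s))) => -[q' n] /= [qn].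
  rewrite (eigen_comp_eig (Yr _ _) h_ss (Delta_ser_eigen HV hh hv n)).
  case: eqP => // qE _; rewrite -qE; congr (_, _).
  by rewrite -qn opprB addrC subrK natrK.
Qed.

Lemma Delta_lin s : linear (fun v => Delta Y h v s).
Proof.
apply: (@fam_sum_lin _ _ _ _ _ (fun x v => eigen_comp h0 (E x.2 v) x.1)).
  by move=> x; exact: lin_comp (E_lin _) (eigen_comp_lin (Yr _ _) h_ss _).
exact: Delta_finsupp.
Qed.

Lemma Delta_eigen q v n : h0 v = ratr q *: v -> Delta Y h v (q - n%:R) = E n v.
Proof.
move=> hv; have Eq m := eigen_comp_eig (Yr _ _) h_ss (Delta_ser_eigen HV hh hv m).
rewrite /Delta (@fsum_one _ _ _ _ (q, n)) //= -/(E _ _) ?Eq ?eqxx // => -[q' m] /= qm ne.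
rewrite -/(E _ _) Eq; case: eqP => // qE; case: ne; rewrite qE; congr (_, _).
by move: qm; rewrite qE => /addrI/oppr_inj/eqP; rewrite eqr_nat => /eqP.
Qed.

Lemma Delta_eigen_neq0 q v s : h0 v = ratr q *: v -> Delta Y h v s <> 0 ->
  exists2 n, s = q - n%:R & E n v <> 0.
Proof.
move=> hv ne; suff [n sE] : exists n, s = q - n%:R.
  by exists n => //; move: ne; rewrite sE (Delta_eigen n hv).
apply: contrapT => nE; apply: ne; apply: fsbig1 => -[q' n] /= qn.
rewrite (eigen_comp_eig (Yr _ _) h_ss (Delta_ser_eigen HV hh hv n)).
by case: eqP => // qE; case: nE; exists n; rewrite -qE.
Qed.

Definition delta_vertex v (r : rat) w := subst_vertex YW (Delta Y h v) r w.

Lemma delta_vertex_finsupp r w v :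
  finsupp [set: int] (fun m => YW (Delta Y h v (m%:~R - r)) m w).
Proof.
move: v; apply: (eigen_ind h_ss) => [|u v fu fv|q v hv].
- apply: (fam_finsupp0 _ (F := fun m v => YW (Delta Y h v (m%:~R - r)) m w)) => m.
  exact: lin_comp (Delta_lin _) (YWl _ _).
- apply: (fam_finsuppD _ (F := fun m v => YW (Delta Y h v (m%:~R - r)) m w)) => // m.
  exact: lin_comp (Delta_lin _) (YWl _ _).
- have [N EN] := Delta_ser_trunc HV Lh hh v.
  apply: sub_finite_set (finite_image (fun n : nat => Num.floor (r + q - n%:R)) (finite_II N)).
  move=> m [_ ne]; have [|n mE En] := @Delta_eigen_neq0 q v (m%:~R - r) hv.
    by move=> D0; apply: ne; rewrite D0 (lin0 (YWl _ _)).
  exists n; first by rewrite /= ltnNge; apply/negP => /EN.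
  have -> : r + q - n%:R = m%:~R by rewrite -addrA -mE addrC subrK.
  by rewrite intrKfloor.
Qed.

Lemma delta_vertex_linl r w : linear (fun v => delta_vertex v r w).
Proof.
apply: (@fam_sum_lin _ _ _ _ _ (fun m v => YW (Delta Y h v (m%:~R - r)) m w)).
  by move=> m; exact: lin_comp (Delta_lin _) (YWl _ _).
exact: delta_vertex_finsupp.
Qed.

(** The product of z^(q-n) and z^(-j-1) contributes to z^(-r-1) exactly when j = r + q - n; hence
    only r in -q + Z occur, the other r being treated by [delta_vertex_eigen0]. *)
Lemma delta_vertex_eigen q v r w (m : int) N : h0 v = ratr q *: v ->
  (forall n, (N <= n)%N -> E n v = 0) -> r + q = m%:~R ->
  delta_vertex v r w = \sum_(n < N) YW (E n v) (m - n%:Z) w.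
Proof.
move=> hv EN rq.
have mE n : (m - n%:Z)%:~R - r = q - n%:R :> rat.
  by rewrite intrD mulrNz -pmulrn -rq; ring.
rewrite /delta_vertex /subst_vertex (@fsum_int_nat _ _ m N).
  by apply: eq_bigr => n _; rewrite mE Delta_eigen.
move=> i ne; have [|n iE En] := @Delta_eigen_neq0 q v (i%:~R - r) hv.
  by move=> D0; apply: ne; rewrite D0 (lin0 (YWl _ _)).
exists n; first by rewrite ltnNge; apply/negP => /EN.
move: iE; rewrite -mE => /addIr/eqP; rewrite eqr_int => /eqP; exact.
Qed.

Lemma delta_vertex_eigen0 q v r w : h0 v = ratr q *: v ->
  r + q \isn't a Num.int -> delta_vertex v r w = 0.
Proof.
move=> hv rq; apply: fsbig1 => m _; apply: contrapT => ne; move/negP: rq; apply.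
have [|n mE _] := @Delta_eigen_neq0 q v (m%:~R - r) hv.
  by move=> D0; apply: ne; rewrite D0 (lin0 (YWl _ _)).
rewrite (_ : r + q = (m + n%:Z)%:~R) ?intr_int // intrD -pmulrn.
by move: mE => /eqP; rewrite subr_eq => /eqP->; ring.
Qed.

Lemma vertex_trunc_nat u v (l : int) : exists T, forall t, (T <= t)%N -> Y u (l + t%:Z) v = 0.
Proof.
have [N HN] := vam_trunc M u v; exists (absz (N - l)) => t Nt; apply: HN; lia.
Qed.

(** [Delta_ser_vertex] spread over a cube, so that its three indices can be summed independently. *)
Lemma delta_vertex_box lam mu u v w (p m : int) (r : rat) N :
  h0 u = ratr lam *: u -> h0 v = ratr mu *: v ->
  (forall n, (N <= n)%N -> E n u = 0) -> (forall n, (N <= n)%N -> E n v = 0) ->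
  (forall a b t, (a < N)%N -> (b < N)%N -> (N <= t)%N -> Y (E a u) (p + t%:Z) (E b v) = 0) ->
  r + (lam + mu) = m%:~R ->
  delta_vertex (Y u p v) r w
  = \sum_(a < N) \sum_(t < N) \sum_(b < N)
      gb (lam - a%:R) t *: YW (Y (E a u) (p + t%:Z) (E b v)) (m - (a + t + b)%N%:Z) w.
Proof.
move=> hu hv Eu Ev uv0 rm.
have huv : h0 (Y u p v) = ratr (lam + mu) *: Y u p v.
  rewrite (h0_deriv h HV) hu hv (linZ (Yl _ _)) (linZ (Yr _ _)) -scalerDl.
  by rewrite rmorphD.
pose F a t b := gb (lam - a%:R) t *: Y (E a u) (p + t%:Z) (E b v).
have F0 a t b : (N <= a)%N || (N <= t)%N || (N <= b)%N -> F a t b = 0.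
  rewrite /F; have [aN|/Eu->] := ltnP a N; last by rewrite (lin0 (Yl _ _)) scaler0.
  have [bN|/Ev->] := ltnP b N; last by rewrite (lin0 (Yr _ _)) scaler0.
  by rewrite orbF orFb => tN; rewrite uv0 // scaler0.
have EF c : E c (Y u p v) = \sum_(s < c.+1) \sum_(a < s.+1) F a (s - a)%N (c - s)%N.
  exact: (Delta_ser_vertex HV hh hu).
(* A nonzero term has a, t and b all below [N], hence c = a + t + b < 3 * N. *)
have E0 c : (3 * N <= c)%N -> E c (Y u p v) = 0.
  move=> Nc; rewrite EF; apply: big1 => s _; apply: big1 => a _.
  have sc := ltn_ord s; have as_ := ltn_ord a.
  by apply: F0; lia.
rewrite (delta_vertex_eigen w huv E0 rm).
pose G a t b := gb (lam - a%:R) t *: YW (Y (E a u) (p + t%:Z) (E b v)) (m - (a + t + b)%N%:Z) w.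
have GF a t b : G a t b = YW (F a t b) (m - (a + t + b)%N%:Z) w.
  by rewrite /G /F (linZ (YWl _ _)).
have G0 a t b : (N <= a)%N || (N <= t)%N || (N <= b)%N -> G a t b = 0.
  by move=> /F0 Fz; rewrite GF Fz (lin0 (YWl _ _)).
transitivity (\sum_(c < 3 * N) \sum_(s < c.+1) \sum_(a < s.+1) G a (s - a)%N (c - s)%N).
  apply: eq_bigr => c _; rewrite EF (lin_sum (YWl _ _)); apply: eq_bigr => s _.
  rewrite (lin_sum (YWl _ _)); apply: eq_bigr => a _; rewrite GF.
  have sc := ltn_ord s; have as_ := ltn_ord a.
  by congr (YW _ _ _); lia.
rewrite (@sum_box _ (fun s b => \sum_(a < s.+1) G a (s - a)%N b) (2 * N) N); last first.
- move=> s b sb; apply: big1 => a _; have as_ := ltn_ord a; apply: G0; lia.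
- lia.
rewrite exchange_big /= [RHS](eq_bigr (fun a : 'I_N => \sum_(b < N) \sum_(t < N) G a t b)).
  rewrite [RHS]exchange_big /=; apply: eq_bigr => b _.
  apply: (@sum_box _ (fun a t => G a t b)); first by lia.
  by move=> a t at_; apply: G0; lia.
by move=> a _; rewrite exchange_big.
Qed.

(** Collecting the terms with I = i + t, Vandermonde turns binom(m-lam, i) and binom(lam-a, t) into
    binom(m-a, I): what remains is the right-hand side of the untwisted identity for each pair
    [E a u], [E b v]. *)
Lemma jacobi_box_rhs lam mu u v w (l m n : int) N :
  h0 u = ratr lam *: u -> h0 v = ratr mu *: v ->
  (forall a, (N <= a)%N -> E a u = 0) -> (forall b, (N <= b)%N -> E b v = 0) ->
  (forall a b t, (a < N)%N -> (b < N)%N -> (N <= t)%N -> Y (E a u) (l + t%:Z) (E b v) = 0) ->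
  (forall t, (N <= t)%N -> Y u (l + t%:Z) v = 0) ->
  \sum_(i \in [set: nat]) gb (m%:~R - lam) i *:
     delta_vertex (Y u (l + i%:Z) v) (m%:~R - lam + (n%:~R - mu) - i%:R) w
  = \sum_(a < N) \sum_(b < N) \sum_(i \in [set: nat]) gb (m - a%:Z)%:~R i *:
      YW (Y (E a u) (l + i%:Z) (E b v)) (m - a%:Z + (n - b%:Z) - i%:Z) w.
Proof.
move=> hu hv Eu Ev uv0 uv0'.
pose G a b I := YW (Y (E a u) (l + I%:Z) (E b v)) (m - a%:Z + (n - b%:Z) - I%:Z) w.
have G0 a b I : (a < N)%N -> (b < N)%N -> (N <= I)%N -> G a b I = 0.
  by move=> aN bN NI; rewrite /G uv0 // (lin0 (YWl _ _)).
rewrite (@fsum_ord _ _ N); last first.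
  by move=> i /uv0'->; rewrite (lin0 (delta_vertex_linl _ _)) scaler0.
transitivity (\sum_(i < N) \sum_(a < N) \sum_(t < N) \sum_(b < N)
   (gb (m%:~R - lam) i * gb (lam - a%:R) t) *: G a b (i + t)%N).
  apply: eq_bigr => i _.
  rewrite (@delta_vertex_box lam mu u v w _ (m + n - i%:Z) _ N) //; last first.
  - by rewrite !intrD mulrNz -pmulrn; ring.
  - by move=> a b t aN bN Nt; rewrite -addrA -PoszD uv0 //; lia.
  rewrite scaler_sumr; apply: eq_bigr => a _.
  rewrite scaler_sumr; apply: eq_bigr => t _.
  rewrite scaler_sumr; apply: eq_bigr => b _.
  rewrite scalerA /G -addrA -PoszD; congr (_ *: YW _ _ _); lia.
rewrite exchange_big; apply: eq_bigr => a _ /=.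
under eq_bigr => i _ do rewrite exchange_big.
rewrite exchange_big; apply: eq_bigr => b _ /=.
rewrite (@fsum_ord _ _ (N + N)); last first.
  by move=> i Ni; rewrite -/(G a b i) G0 ?scaler0 //; lia.
rewrite -(@sum_box _ (fun i t => (gb (m%:~R - lam) i * gb (lam - a%:R) t) *: G a b (i + t)%N)
  N N (N + N)) //; last first.
  by move=> s t st; rewrite G0 ?scaler0 //; lia.
apply: eq_bigr => I _; rewrite -/(G a b I).
have -> : (m - a%:Z)%:~R = m%:~R - lam + (lam - a%:R) :> rat.
  by rewrite intrD mulrNz -pmulrn; ring.
rewrite -gbinom_vandermonde scaler_suml; apply: eq_bigr => i _.
by rewrite subnKC // -ltnS.
Qed.

Lemma module_trunc_finsupp (U : lmodType R[i]) (c : nat -> R[i]) (f : nat -> W -> U)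
    v (n : int) w : (forall i, linear (f i)) ->
  finsupp [set: nat] (fun i => c i *: f i (YW v (n + i%:Z) w)).
Proof.
move=> lf; have [N HN] := vam_trunc MW v w.
apply: sub_finite_set (finite_II (absz (N - n))) => i [_ ne] /=.
rewrite ltnNge; apply/negP => Ni; apply: ne.
by rewrite HN ?(lin0 (lf i)) ?scaler0 //; lia.
Qed.

(** On eigenvectors every mode is a finite sum of untwisted modes, so the left-hand side is a sum
    over (a, b) of untwisted left-hand sides, matched term by term with [jacobi_box_rhs]. *)
Lemma delta_vertex_jacobi lam mu u v w (l m n : int) :
  h0 u = ratr lam *: u -> h0 v = ratr mu *: v ->
  (\sum_(i \in [set: nat]) ((-1) ^+ i * gb l%:~R i) *:
     delta_vertex u (l%:~R + (m%:~R - lam) - i%:R)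
       (delta_vertex v (n%:~R - mu + i%:R) w))
  - (\sum_(i \in [set: nat]) ((-1) ^ (l + i%:Z) * gb l%:~R i) *:
     delta_vertex v (l%:~R + (n%:~R - mu) - i%:R)
       (delta_vertex u (m%:~R - lam + i%:R) w))
  = \sum_(i \in [set: nat]) gb (m%:~R - lam) i *:
     delta_vertex (Y u (l + i%:Z) v) (m%:~R - lam + (n%:~R - mu) - i%:R) w.
Proof.
move=> hu hv.
have [N1 Eu1] := Delta_ser_trunc HV Lh hh u.
have [N2 Ev1] := Delta_ser_trunc HV Lh hh v.
pose N0 := maxn N1 N2.
have [N3 HN3] : exists T, forall a t, (a < N0)%N -> (T <= t)%N ->
    forall b, (b < N0)%N -> Y (E a u) (l + t%:Z) (E b v) = 0.
  apply: bound_uniform => a.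
  have [T HT] := @bound_uniform (fun b t => Y (E a u) (l + t%:Z) (E b v) = 0) N0
    (fun b => vertex_trunc_nat (E a u) (E b v) l).
  by exists T => t Tt b bN; exact: HT.
have [N4 HN4] := vertex_trunc_nat u v l.
pose N := maxn N0 (maxn N3 N4).
have Eu a : (N <= a)%N -> E a u = 0 by move=> Na; apply: Eu1; rewrite /N /N0 in Na; lia.
have Ev b : (N <= b)%N -> E b v = 0 by move=> Nb; apply: Ev1; rewrite /N /N0 in Nb; lia.
have uv0 a b t : (a < N)%N -> (b < N)%N -> (N <= t)%N -> Y (E a u) (l + t%:Z) (E b v) = 0.
  move=> aN bN Nt; have [aN0|Na] := ltnP a N0; last first.
    by rewrite Eu1 ?(lin0 (Yl _ _)) //; rewrite /N0 in Na; lia.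
  have [bN0|Nb] := ltnP b N0; last first.
    by rewrite Ev1 ?(lin0 (Yr _ _)) //; rewrite /N0 in Nb; lia.
  by apply: HN3 => //; rewrite /N in Nt; lia.
have uv0' t : (N <= t)%N -> Y u (l + t%:Z) v = 0.
  by move=> Nt; apply: HN4; rewrite /N in Nt; lia.
rewrite (jacobi_box_rhs _ _ _ hu hv Eu Ev uv0 uv0').
have Yu (j : int) x : delta_vertex u (j%:~R - lam) x = \sum_(a < N) YW (E a u) (j - a%:Z) x.
  by apply: (delta_vertex_eigen _ hu) => //; rewrite subrK.
have Yv (j : int) x : delta_vertex v (j%:~R - mu) x = \sum_(b < N) YW (E b v) (j - b%:Z) x.
  by apply: (delta_vertex_eigen _ hv) => //; rewrite subrK.
under [X in X - _]eq_fsbigr => i _.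
  rewrite (_ : l%:~R + (m%:~R - lam) - i%:R = (l + m - i%:Z)%:~R - lam); last first.
    by rewrite !intrD mulrNz -pmulrn; ring.
  rewrite (_ : n%:~R - mu + i%:R = (n + i%:Z)%:~R - mu); last first.
    by rewrite !intrD -pmulrn; ring.
  rewrite Yu Yv scaler_sumr.
  under eq_bigr => a _ do rewrite (lin_sum (YWr _ _)) scaler_sumr.
  over.
under [X in _ - X]eq_fsbigr => i _.
  rewrite (_ : l%:~R + (n%:~R - mu) - i%:R = (l + n - i%:Z)%:~R - mu); last first.
    by rewrite !intrD mulrNz -pmulrn; ring.
  rewrite (_ : m%:~R - lam + i%:R = (m + i%:Z)%:~R - lam); last first.
    by rewrite !intrD -pmulrn; ring.
  rewrite Yu Yv scaler_sumr.
  under eq_bigr => b _ do rewrite (lin_sum (YWr _ _)) scaler_sumr.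
  rewrite exchange_big /=.
  over.
have f1 (a b : nat) : finsupp [set: nat] (fun i : nat => ((-1) ^+ i * gb l%:~R i) *:
    YW (E a u) (l + m - i%:Z - a%:Z) (YW (E b v) (n + i%:Z - b%:Z) w)).
  under eq_fun do rewrite (addrAC n).
  exact: (module_trunc_finsupp _ (f := fun i => YW (E a u) (l + m - i%:Z - a%:Z))).
have f2 (a b : nat) : finsupp [set: nat] (fun i : nat => ((-1) ^ (l + i%:Z) * gb l%:~R i) *:
    YW (E b v) (l + n - i%:Z - b%:Z) (YW (E a u) (m + i%:Z - a%:Z) w)).
  under eq_fun do rewrite (addrAC m).
  exact: (module_trunc_finsupp _ (f := fun i => YW (E b v) (l + n - i%:Z - b%:Z))).
rewrite !fsum_sum; try by move=> a; apply: finsupp_sum.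
rewrite -sumrB; apply: eq_bigr => a _.
rewrite !fsum_sum //.
rewrite -sumrB; apply: eq_bigr => b _.
rewrite -(vam_jacobi MW); congr (_ - _); apply: eq_fsbigr => i _.
  by congr (_ *: YW _ _ (YW _ _ _)); lia.
by congr (_ *: YW _ _ (YW _ _ _)); lia.
Qed.

Lemma delta_vertex_vac r w : delta_vertex vac r w = if r == -1 then w else 0.
Proof.
have hv : h0 vac = ratr 0 *: vac by rewrite rmorph0 scale0r (va_creation (voa_va HV) h 0).
have [/intrP[m rm]|nint] := boolP (r \is a Num.int); last first.
  rewrite (@delta_vertex_eigen0 0) ?addr0 //; case: eqP => // r1.
  by move: nint; rewrite r1 -[-1]/((-1)%:~R) intr_int.
rewrite (@delta_vertex_eigen 0 vac r w m 1) //; last 2 first.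
- by case=> // n _; rewrite (Delta_ser_vac HV hh).
- by rewrite addr0.
rewrite big_ord1 subr0 (Delta_ser_vac HV hh) (vam_vac MW) rm.
by rewrite -[-1 in RHS]/((-1)%:~R) eqr_int.
Qed.

Lemma delta_vertex_linr v r : linear (delta_vertex v r).
Proof.
move=> a w1 w2; move: v; apply: (eigen_ind h_ss) => [|u v IHu IHv|q v hv].
- by rewrite !(lin0 (delta_vertex_linl _ _)) scaler0 addr0.
- by rewrite !(linD (delta_vertex_linl _ _)) IHu IHv scalerDr addrACA.
- have [/intrP[m rm]|nint] := boolP (r + q \is a Num.int); last first.
    by rewrite !(delta_vertex_eigen0 _ hv) // scaler0 addr0.
  have [N EN] := Delta_ser_trunc HV Lh hh v.
  rewrite !(delta_vertex_eigen _ hv EN rm) scaler_sumr -big_split.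
  by apply: eq_bigr => n _; rewrite YWr.
Qed.

Lemma delta_vertex_trunc v w : exists N : rat, forall r, N <= r -> delta_vertex v r w = 0.
Proof.
move: v; apply: (eigen_ind h_ss) => [|u v [N1 H1] [N2 H2]|q v hv].
- by exists 0 => r _; rewrite (lin0 (delta_vertex_linl _ _)).
- exists (Num.max N1 N2) => r; rewrite ge_max => /andP[? ?].
  by rewrite (linD (delta_vertex_linl _ _)) H1 // H2 // addr0.
- have [N EN] := Delta_ser_trunc HV Lh hh v.
  have [T HT] : exists T, forall n t, (n < N)%N -> (T <= t)%N -> YW (E n v) t%:Z w = 0.
    apply: bound_uniform => n; have [T HT] := vam_trunc MW (E n v) w.
    by exists (absz T) => t Tt; apply: HT; lia.
  exists ((T + N)%:R - q) => r Nr.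
  have [/intrP[m rm]|nint] := boolP (r + q \is a Num.int); last first.
    by rewrite (delta_vertex_eigen0 _ hv).
  rewrite (delta_vertex_eigen _ hv EN rm); apply: big1 => n _.
  have Tm : (T + N)%N%:Z <= m by rewrite -(ler_int rat) -rm -lerBlDr -pmulrn.
  have nN := ltn_ord n.
  have -> : m - n%:Z = (absz (m - n%:Z))%:Z by lia.
  by apply: HT => //; lia.
Qed.

(** * The twisted module axioms for an automorphism of order k *)

Section Order.
Variable k : nat.
Local Notation sigma := (expipi_op h0 2).
Hypothesis sigma_k : has_order sigma k.

Let k_gt0 : (0 < k)%N. Proof. by case: sigma_k. Qed.
Let kn0 : k%:R != 0 :> rat. Proof. by rewrite pnatr_eq0 -lt0n. Qed.

(** sigma^k = 1 forces e^(2 pi i k q) = 1; this controls the denominators in [tm_supp]. *)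
Lemma eigenvalue_denominator q v : h0 v = ratr q *: v -> v <> 0 ->
  k%:R * q \is a Num.int.
Proof.
move=> hv v0; have [_ sk _] := sigma_k; apply: (@expipi_eq1 R).
have sv n : iter n sigma v = expipi R (2 * q) ^+ n *: v.
  elim: n => [|n IH]; first by rewrite scale1r.
  rewrite iterS IH (linZ (expipi_op_lin (Yr _ _) h_ss _)).
  by rewrite (expipi_op_eig (Yr _ _) h_ss _ hv) scalerA exprSr.
have := sk v; rewrite sv expipiX => /eqP; rewrite -subr_eq0 -[X in _ - X]scale1r -scalerBl.
rewrite scaler_eq0 subr_eq0 => /orP[/eqP|/eqP//].
by rewrite mulrCA.
Qed.

Let tau := expipi_op h0 (- 2^-1).
Let Y2 (v : V) := delta_vertex (tau v).

Let tau_lin : linear tau. Proof. exact: expipi_op_lin. Qed.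
Let tau_eig q v : h0 v = ratr q *: v -> tau v = expipi R (- 2^-1 * q) *: v.
Proof. exact: (expipi_op_eig (Yr _ _) h_ss). Qed.

Let Y2_linl r w : linear (fun v => Y2 v r w).
Proof. exact: lin_comp tau_lin (delta_vertex_linl r w). Qed.

Let Y2_eig q v r w : h0 v = ratr q *: v ->
  Y2 v r w = expipi R (- 2^-1 * q) *: delta_vertex v r w.
Proof. by move=> hv; rewrite /Y2 (tau_eig hv) (linZ (delta_vertex_linl _ _)). Qed.

Let Y2_eig0 q v r w : h0 v = ratr q *: v -> r + q \isn't a Num.int -> Y2 v r w = 0.
Proof. by move=> hv nint; rewrite (Y2_eig _ _ hv) (delta_vertex_eigen0 _ hv) // scaler0. Qed.

Let Y2_supp v r w : Y2 v r w != 0 -> k%:R * r \is a Num.int.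
Proof.
apply: contraNT => nint; apply/eqP; move: v.
apply: (eigen_ind h_ss) => [|u v IHu IHv|q v hv].
- exact: lin0 (Y2_linl _ _).
- by rewrite (linD (Y2_linl _ _)) IHu IHv addr0.
- have [->|/eqP v0] := eqVneq v 0; first exact: lin0 (Y2_linl _ _).
  apply: (Y2_eig0 _ hv); apply: contra nint => rq.
  have -> : k%:R * r = k%:R * (r + q) - k%:R * q by ring.
  apply: rpredB (eigenvalue_denominator hv v0).
  by apply: rpredM rq; exact: natr_int.
Qed.

Let Y2_equiv v (n : int) w : Y2 (sigma v) (n%:~R / k%:R) w
  = twist_root R k ^ (n + k%:Z) *: Y2 v (n%:~R / k%:R) w.
Proof.
have s_lin : linear sigma by exact: expipi_op_lin.
move: v; apply: (eigen_ind h_ss) => [|u v IHu IHv|q v hv].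
- by rewrite (lin0 s_lin) (lin0 (Y2_linl _ _)) scaler0.
- by rewrite (linD s_lin) !(linD (Y2_linl _ _)) scalerDr IHu IHv.
- rewrite (expipi_op_eig (Yr _ _) h_ss _ hv) (linZ (Y2_linl _ _)).
  have [/intrP[m rm]|nint] := boolP (n%:~R / k%:R + q \is a Num.int); last first.
    by rewrite (Y2_eig0 _ hv) // !scaler0.
  congr (_ *: _); rewrite /twist_root expipiXz.
  (* With n/k = m - q, the exponent -2(n+k)/k is 2q modulo 2Z. *)
  have -> : (n + k%:Z)%:~R * (- 2 / k%:R) = 2 * q + 2 * (- m - 1)%:~R.
    rewrite !intrD !mulrNz -pmulrn -rm -[1%:~R]/1.
    by field.
  by rewrite expipiD expipi_2int mulr1.
Qed.

Let S1 (l : int) (m n : rat) w u v := \sum_(i \in [set: nat]) ((-1) ^+ i * gb l%:~R i) *: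
  Y2 u (l%:~R + m - i%:R) (Y2 v (n + i%:R) w).
Let S2 (l : int) (m n : rat) w u v := \sum_(i \in [set: nat]) ((-1) ^ (l + i%:Z) * gb l%:~R i) *:
  Y2 v (l%:~R + n - i%:R) (Y2 u (m + i%:R) w).
Let S3 (l : int) (m n : rat) w u v := \sum_(i \in [set: nat]) gb m i *:
  Y2 (Y u (l + i%:Z) v) (m + n - i%:R) w.

Let Y2_trunc v w : exists N : rat, forall r, N <= r -> Y2 v r w = 0.
Proof. exact: delta_vertex_trunc. Qed.

Let Y2_finsupp (c : nat -> R[i]) (f : nat -> W -> W) v (n : rat) w :
  (forall i, linear (f i)) ->
  finsupp [set: nat] (fun i => c i *: f i (Y2 v (n + i%:R) w)).
Proof.
move=> lf; have [N HN] := Y2_trunc v w.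
have NK := ltW (truncnS_gt (N - n)).
apply: sub_finite_set (finite_II (Num.truncn (N - n)).+1) => i [_ ne] /=.
rewrite ltnNge; apply/negP => Ni; apply: ne.
rewrite HN ?(lin0 (lf i)) ?scaler0 //.
by rewrite -lerBlDl (le_trans NK) // ler_nat.
Qed.

Let Y2_linr v r : linear (Y2 v r). Proof. exact: delta_vertex_linr. Qed.

Let S1_linl l m n w v : linear (fun u => S1 l m n w u v).
Proof.
apply: (@fam_sum_lin _ _ _ _ _ (fun i u => ((-1) ^+ i * gb l%:~R i) *:
  Y2 u (l%:~R + m - i%:R) (Y2 v (n + i%:R) w))) => [i|u].
  by apply: linZl; exact: Y2_linl.
by apply: (@Y2_finsupp _ (fun i => Y2 u (l%:~R + m - i%:R))) => i; exact: Y2_linr.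
Qed.

Let S1_linr l m n w u : linear (fun v => S1 l m n w u v).
Proof.
apply: (@fam_sum_lin _ _ _ _ _ (fun i v => ((-1) ^+ i * gb l%:~R i) *:
  Y2 u (l%:~R + m - i%:R) (Y2 v (n + i%:R) w))) => [i|v].
  by apply: linZl; exact: lin_comp (Y2_linl _ _) (Y2_linr _ _).
by apply: (@Y2_finsupp _ (fun i => Y2 u (l%:~R + m - i%:R))) => i; exact: Y2_linr.
Qed.

Let S2_linl l m n w v : linear (fun u => S2 l m n w u v).
Proof.
apply: (@fam_sum_lin _ _ _ _ _ (fun i u => ((-1) ^ (l + i%:Z) * gb l%:~R i) *:
  Y2 v (l%:~R + n - i%:R) (Y2 u (m + i%:R) w))) => [i|u].
  by apply: linZl; exact: lin_comp (Y2_linl _ _) (Y2_linr _ _).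
by apply: (@Y2_finsupp _ (fun i => Y2 v (l%:~R + n - i%:R))) => i; exact: Y2_linr.
Qed.

Let S2_linr l m n w u : linear (fun v => S2 l m n w u v).
Proof.
apply: (@fam_sum_lin _ _ _ _ _ (fun i v => ((-1) ^ (l + i%:Z) * gb l%:~R i) *:
  Y2 v (l%:~R + n - i%:R) (Y2 u (m + i%:R) w))) => [i|v].
  by apply: linZl; exact: Y2_linl.
by apply: (@Y2_finsupp _ (fun i => Y2 v (l%:~R + n - i%:R))) => i; exact: Y2_linr.
Qed.

Let S3_finsupp l m n w u v : finsupp [set: nat]
  (fun i => gb m i *: Y2 (Y u (l + i%:Z) v) (m + n - i%:R) w).
Proof.
have [N HN] := vertex_trunc_nat u v l.
apply: sub_finite_set (finite_II N) => i [_ ne] /=.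
rewrite ltnNge; apply/negP => Ni; apply: ne.
by rewrite HN // (lin0 (Y2_linl _ _)) scaler0.
Qed.

Let S3_linl l m n w v : linear (fun u => S3 l m n w u v).
Proof.
apply: (@fam_sum_lin _ _ _ _ _ (fun i u => gb m i *:
  Y2 (Y u (l + i%:Z) v) (m + n - i%:R) w)) => [i|u].
  by apply: linZl; exact: lin_comp (Yl _ _) (Y2_linl _ _).
exact: S3_finsupp.
Qed.

Let S3_linr l m n w u : linear (fun v => S3 l m n w u v).
Proof.
apply: (@fam_sum_lin _ _ _ _ _ (fun i v => gb m i *:
  Y2 (Y u (l + i%:Z) v) (m + n - i%:R) w)) => [i|v].
  by apply: linZl; exact: lin_comp (Yr _ _) (Y2_linl _ _).
exact: S3_finsupp.
Qed.

(** The defect of the twisted Jacobi identity. The integrality condition is frozen in [b], which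
    makes the defect linear in [u] and in [v], so that its vanishing can be tested on
    eigenvectors. *)
Let J (b : bool) l m n w u v :=
  S1 l m n w u v - S2 l m n w u v - (if b then S3 l m n w u v else 0).

Let J_linl b l m n w v : linear (fun u => J b l m n w u v).
Proof. by apply: lin_sub; [exact: lin_sub | apply: lin_if; exact: S3_linl]. Qed.

Let J_linr b l m n w u : linear (fun v => J b l m n w u v).
Proof. by apply: lin_sub; [exact: lin_sub | apply: lin_if; exact: S3_linr]. Qed.

(** h(0) is a derivation, so its exponential [tau] is multiplicative; this carries the Jacobi
    identity from [delta_vertex] to [Y2]. *)
Let tau_vertex lam mu u v p : h0 u = ratr lam *: u -> h0 v = ratr mu *: v ->
  tau (Y u p v) = Y (tau u) p (tau v).
Proof.
move=> hu hv; rewrite (tau_eig hu) (tau_eig hv) (linZ (Yl _ _)) (linZ (Yr _ _)).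
rewrite (@tau_eig (lam + mu)).
  by rewrite scalerA mulrDr expipiD.
by rewrite (h0_deriv h HV) hu hv (linZ (Yl _ _)) (linZ (Yr _ _)) -scalerDl rmorphD.
Qed.

Let tau_hom lam u : h0 u = ratr lam *: u -> h0 (tau u) = ratr lam *: tau u.
Proof. by move=> hu; rewrite (tau_eig hu) (linZ (Yr _ _)) hu !scalerA mulrC. Qed.

Let J_eigen lam mu l m n w u v : h0 u = ratr lam *: u -> h0 v = ratr mu *: v ->
  J (m + lam \is a Num.int) l m n w u v = 0.
Proof.
move=> hu hv.
have int_shift (q r : rat) (i : nat) :
    (q + i%:R + r \is a Num.int) = (q + r \is a Num.int).
  by rewrite addrAC rpredDr // natr_int.
have int_shiftB (q r : rat) (i : nat) :
    (l%:~R + q - i%:R + r \is a Num.int) = (q + r \is a Num.int).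
  by rewrite addrAC rpredBr ?natr_int // -addrA rpredDl // intr_int.
rewrite /J; case: ifPn => [/intrP[m' mE]|m_int]; last first.
  rewrite subr0 /S1 /S2 !fsbig1 ?subr0 // => i _.
    by rewrite (@Y2_eig0 lam u) ?int_shift // (lin0 (Y2_linr _ _)) scaler0.
  by rewrite (@Y2_eig0 lam u) ?int_shiftB // scaler0.
(* If n + mu is not integral, then m + n - i + lam + mu is not either, and the right-hand side
   vanishes along with the left. *)
have [/intrP[n' nE]|n_int] := boolP (n + mu \is a Num.int); last first.
  rewrite /S1 /S2 /S3 !fsbig1 ?subr0 // => i _.
  - rewrite (@Y2_eig0 (lam + mu)) ?scaler0 //.
      by rewrite (h0_deriv h HV) hu hv (linZ (Yl _ _)) (linZ (Yr _ _)) -scalerDl rmorphD.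
    rewrite (_ : m + n - i%:R + (lam + mu) = m'%:~R - i%:R + (n + mu)); last by rewrite -mE; ring.
    by rewrite rpredDl // rpredB ?intr_int ?natr_int.
  - by rewrite (@Y2_eig0 mu v) ?int_shiftB // scaler0.
  - by rewrite (@Y2_eig0 mu v) ?int_shift // (lin0 (Y2_linr _ _)) scaler0.
have -> : m = m'%:~R - lam by rewrite -mE addrK.
have -> : n = n'%:~R - mu by rewrite -nE addrK.
rewrite /S1 /S2 /Y2 (delta_vertex_jacobi _ _ _ _ (tau_hom hu) (tau_hom hv)).
apply/eqP; rewrite subr_eq0; apply/eqP/eq_fsbigr => i _.
by rewrite /Y2 (tau_vertex _ hu hv).
Qed.

Let Y2_jacobi : twisted_jacobi Y sigma k Y2.
Proof.
move=> j u v w l m n jk su; apply/eqP; rewrite -subr_eq0; apply/eqP.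
rewrite -/(J _ l m n w u v).
have [fu hu ->] := ecompP h_ss u; set c := ecomp _ _ u in fu hu *.
rewrite (fsum_seq fu) //; last by move=> q _ /negP; rewrite negbK => /eqP.
rewrite (lin_sum (J_linl _ _ _ _ _ _)); apply: big1 => q _.
have [->|c0] := eqVneq (c q) 0; first exact: lin0 (J_linl _ _ _ _ _ _).
have s_lin : linear sigma by exact: expipi_op_lin.
(* The h(0)-components of [u] inherit its eigenvalue under [sigma], because [sigma] commutes with
   h(0). *)
have cs : sigma (c q) = twist_root R k ^+ j *: c q.
  have s_comm x : h0 (sigma x) = sigma (h0 x).
    move: x; apply: (eigen_ind h_ss) => [|x y IHx IHy|r x hx].
    - by rewrite !(lin0 s_lin, lin0 (Yr _ _)).
    - by rewrite !(linD s_lin, linD (Yr _ _)) IHx IHy.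
    - rewrite (expipi_op_eig (Yr _ _) h_ss _ hx) hx (linZ (Yr _ _)) (linZ s_lin).
      by rewrite (expipi_op_eig (Yr _ _) h_ss _ hx) hx !scalerA mulrC.
  rewrite -(ecomp_comm (@ratr_inj R) (Yr _ _) h_ss u q s_lin s_comm) su.
  exact: (linZ (ecomp_lin (@ratr_inj R) (Yr _ _) h_ss q)).
(* Comparing e^(2 pi i q) with the power of [twist_root] gives q = -j/k modulo Z, so the integrality
   test on m - j/k is the one on m + q. *)
have qj : q + j%:R / k%:R \is a Num.int.
  apply: (@expipi_eq1 R); move: cs; rewrite (expipi_op_eig (Yr _ _) h_ss _ (hu q)).
  rewrite /twist_root expipiX => /eqP; rewrite -subr_eq0 -scalerBl scaler_eq0 (negbTE c0).
  rewrite orbF subr_eq0 => /eqP eq; rewrite mulrDr expipiD eq -expipiD -[RHS](@expipi0 R).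
  by congr expipi; field.
have -> : (m - j%:R / k%:R \is a Num.int) = (m + q \is a Num.int).
  have -> : m + q = m - j%:R / k%:R + (q + j%:R / k%:R) by ring.
  by rewrite [RHS]rpredDr.
move: v; apply: (eigen_ind h_ss) => [|x y IHx IHy|r x hx].
- exact: lin0 (J_linr _ _ _ _ _ _).
- by rewrite (linD (J_linr _ _ _ _ _ _)) IHx IHy addr0.
- exact: J_eigen (hu q) hx.
Qed.

Lemma delta_vertex_twisted : twisted_module Y vac sigma k Y2.
Proof.
split=> //.
- move=> r w; rewrite /Y2 (@tau_eig 0) ?mulr0 ?expipi0 ?scale1r.
    exact: delta_vertex_vac.
  by rewrite rmorph0 scale0r (va_creation (voa_va HV) h 0).
Qed.

End Order.
End Twisted.

(** * Contragredient duals *)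

Section Separation.
Variables (R : realType) (W : lmodType R[i]).

(** Coordinates in a spanning family of least size are well defined on [A], and one of them is
    nonzero at [x]. Off [A] they are arbitrary, whence linearity is claimed only inside [A]. *)
Lemma finite_dim_separates (A : set W) x : finite_dim A -> A x -> x <> 0 ->
  exists g : W -> R[i], g x <> 0 /\
    forall a u v, A u -> A v -> A (a *: u + v) -> g (a *: u + v) = a * g u + g v.
Proof.
pose spans d (b : 'I_d -> W) := forall v, A v ->
  exists c : 'I_d -> R[i], v = \sum_(i < d) c i *: b i.
move=> [d0 [b0 sb0]] Ax x0.
have exd : exists d, `[< exists b : 'I_d -> W, spans d b >].
  by exists d0; apply/asboolP; exists b0.
case: (ex_minnP exd) => d /asboolP[b sb] dmin.
(* A relation with [c j] nonzero expresses [b j] through the others, and deleting it contradicts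
   minimality. *)
have b_free (c : 'I_d -> R[i]) : \sum_(i < d) c i *: b i = 0 -> forall i, c i = 0.
  move=> cb j; apply: contrapT => /eqP cj.
  case: d => [|d] in b sb dmin c cb j cj *; first by case: j cj.
  have : (d.+1 <= d)%N; last by rewrite ltnn.
  apply/dmin/asboolP; exists (b \o lift j) => v /sb[c' ->].
  exists (fun i => c' (lift j i) - c' j / c j * c (lift j i)).
  have bj : b j = - (c j)^-1 *: \sum_(i < d) c (lift j i) *: b (lift j i).
    move: cb; rewrite (bigD1_ord j) //= => /eqP; rewrite addr_eq0 => /eqP cb.
    by rewrite scaleNr -scalerN -cb scalerA mulVf // scale1r.
  rewrite (bigD1_ord j) //= bj scalerA scaler_sumr -big_split; apply: eq_bigr => i _ /=.
  by rewrite scalerA -scalerDl; congr (_ *: _); rewrite mulrN mulNr addrC.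
pose coord v : 'I_d -> R[i] := xget (fun=> 0) [set c | v = \sum_(i < d) c i *: b i].
have coordE v : A v -> v = \sum_(i < d) coord v i *: b i.
  by move=> /sb[c vc]; rewrite /coord; case: xgetP => [c' _ //|/(_ c)].
have [i ci] : exists i, coord x i <> 0.
  apply: contrapT => no; apply: x0; rewrite (coordE x Ax); apply: big1 => i _.
  by case: (EM (coord x i = 0)) => [->|ne]; [rewrite scale0r | case: no; exists i].
exists (fun v => coord v i); split=> // a u v Au Av Auv.
apply/eqP; rewrite -subr_eq0; apply/eqP.
apply: (b_free (fun i => coord (a *: u + v) i - (a * coord u i + coord v i))).
under eq_bigr do rewrite scalerBl scalerDl -scalerA.
by rewrite sumrB big_split /= -scaler_sumr -!coordE // subrr.
Qed.

(** A functional on one weight space, composed with the projection onto it, vanishes on all the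
    other weight spaces and so lies in the restricted dual. *)
Lemma weight_graded_separates (T : W -> W) x : linear T -> weight_graded T -> x <> 0 ->
  exists f : W -> R[i], [/\ scalar f,
    finite_set [set a : R[i] | exists2 w, T w = a *: w & f w != 0] & f x <> 0].
Proof.
move=> lT gT x0; have T_ss := wg_decomp gT.
have id_inj : injective (fun a : R[i] => a) by [].
pose c v a := ecomp (fun a : R[i] => a) T v a.
have Tc v a : T (c v a) = a *: c v a by have [_] := ecompP T_ss v.
have c_lin a : linear (fun v => c v a) by exact: ecomp_lin.
have [a ca] : exists a, c x a <> 0.
  apply: contrapT => no; apply: x0; have [_ _ ->] := ecompP T_ss x.
  by apply: fsbig1 => a _; apply: contrapT => ne; apply: no; exists a.
have [g [gx g_lin]] := finite_dim_separates (wg_findim gT a) (Tc x a) ca.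
have g0 : g 0 = 0.
  have T0 : T 0 = a *: 0 by rewrite (lin0 lT) scaler0.
  by have := g_lin (-1) 0 0 T0 T0; rewrite scaler0 addr0 mulN1r addNr; exact.
exists (fun v => g (c v a)); split=> //.
- by move=> b u v; rewrite c_lin g_lin //= lT !Tc scalerDr !scalerA mulrC.
- apply: sub_finite_set (finite_set1 a) => b [w Tw]; rewrite /c (ecomp_eig id_inj lT T_ss Tw).
  by case: (a =P b) => [->//|_]; rewrite g0 eqxx.
Qed.

End Separation.

(** * Coefficients of contragredient operators on eigenvectors *)

Section ContraCoef.
Variables (R : realType) (V : lmodType R[i]) (T1 T0 : V -> V).
Hypotheses (T1_lin : linear T1) (T0_lin : linear T0) (T0_ss : semisimple ratr T0).
Hypothesis T1_nil : forall v, exists N, forall n, (N <= n)%N -> iter n T1 v = 0.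

Let c (x : rat * nat) (v : V) : V :=
  ((x.2`!%:R)^-1 * expipi R x.1) *: iter x.2 T1 (eigen_comp T0 v x.1).

Let c_lin x : linear (c x).
Proof.
apply: linZl; apply: (lin_comp (f := fun v => eigen_comp T0 v x.1)).
  exact: eigen_comp_lin.
exact: lin_iter.
Qed.

Lemma contra_ser_lin s : linear (fun v => contra_ser T1 T0 v s).
Proof.
apply: (fam_sum_lin (F := c)) => [//|v].
apply: sub_finite_set (finite_image (fun q => (q, Num.truncn (s + 2 * q)))
  (eigen_comp_finsupp T0_ss v)).
move=> [q n] /= [qn ne]; exists q; last by rewrite -qn subrK natrK.
by move=> q0; apply: ne; rewrite /c /= q0 (lin0 (lin_iter _ T1_lin)) scaler0.
Qed.

Lemma contra_ser_eig q v n : T0 v = ratr q *: v ->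
  contra_ser T1 T0 v (n%:R - 2 * q) = ((n`!%:R)^-1 * expipi R q) *: iter n T1 v.
Proof.
move=> Tv; have Eq := eigen_comp_eig T0_lin T0_ss Tv.
rewrite /contra_ser (@fsum_one _ _ _ _ (q, n)) //= ?Eq ?eqxx // => -[q' m] /= qm ne.
case: eqP => [qE|_]; last by rewrite (lin0 (lin_iter _ T1_lin)) scaler0.
case: ne; rewrite qE; congr (_, _).
by move: qm; rewrite qE => /addIr/eqP; rewrite eqr_nat => /eqP.
Qed.

Lemma contra_ser_neq0 q v s : T0 v = ratr q *: v -> contra_ser T1 T0 v s <> 0 ->
  exists2 n, s = n%:R - 2 * q & iter n T1 v <> 0.
Proof.
move=> Tv ne; suff [n sE] : exists n, s = n%:R - 2 * q.
  exists n => // n0; apply: ne.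
  by rewrite sE contra_ser_eig // n0 scaler0.
apply: contrapT => nE; apply: ne; apply: fsbig1 => -[q' n] /= qn.
rewrite (eigen_comp_eig T0_lin T0_ss Tv).
case: eqP => [qE|_]; last by rewrite (lin0 (lin_iter _ T1_lin)) scaler0.
by case: nE; exists n; rewrite -qE.
Qed.

Variable F : V -> int -> R[i].
Hypothesis F_lin : forall m, linear (fun v => F v m : R[i]^o).

Let d r (m : int) (v : V) : R[i]^o := F (contra_ser T1 T0 v (- r - 2 - m%:~R)) m.

Let d_lin r m : linear (d r m).
Proof. exact: lin_comp (contra_ser_lin _) (F_lin m). Qed.

Lemma contra_coef_lin r : linear (fun v => contra_coef T1 T0 F v r : R[i]^o).
Proof.
apply: (fam_sum_lin (F := d r)) => [//|].
apply: (eigen_ind T0_ss) => [|u v fu fv|q v Tv].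
- exact: fam_finsupp0.
- exact: fam_finsuppD.
- have [N TN] := T1_nil v.
  apply: sub_finite_set (finite_image
    (fun n : nat => Num.floor (- r - 2 - (n%:R - 2 * q))) (finite_II N)).
  move=> m [_ ne]; have [|n mE Tn] := @contra_ser_neq0 q v (- r - 2 - m%:~R) Tv.
    by move=> D0; apply: ne; rewrite /d D0 (lin0 (F_lin m)).
  exists n; first by rewrite /= ltnNge; apply/negP => /TN.
  by rewrite -mE (_ : _ - _ = m%:~R) ?intrKfloor //; ring.
Qed.

(** At z^-1 the mode j carries z^(j+1); together with z^(n-2q) this yields z^(-r-1) exactly for j =
    2q - r - 2 - n. *)
Lemma contra_coef_eig q v r (m : int) N : T0 v = ratr q *: v ->
  (forall n, (N <= n)%N -> iter n T1 v = 0) -> 2 * q - r = m%:~R ->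
  contra_coef T1 T0 F v r
  = \sum_(n < N) F (((n`!%:R)^-1 * expipi R q) *: iter n T1 v) (m - 2 - n%:Z).
Proof.
move=> Tv TN rm.
have mE n : - r - 2 - (m - 2 - n%:Z)%:~R = n%:R - 2 * q :> rat.
  by rewrite !intrD !mulrNz -pmulrn -rm -[2%:~R]/(2 : rat); ring.
rewrite /contra_coef (@fsum_int_nat _ _ (m - 2) N).
  by apply: eq_bigr => n _; rewrite mE contra_ser_eig.
move=> i ne; have [|n iE Tn] := @contra_ser_neq0 q v (- r - 2 - i%:~R) Tv.
  by move=> D0; apply: ne; rewrite D0 (lin0 (F_lin i)).
exists n; first by rewrite ltnNge; apply/negP => /TN.
by move: iE; rewrite -mE => /addrI/oppr_inj/eqP; rewrite eqr_int => /eqP.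
Qed.

Lemma contra_coef_eig0 q v r : T0 v = ratr q *: v -> 2 * q - r \isn't a Num.int ->
  contra_coef T1 T0 F v r = 0.
Proof.
move=> Tv nint; apply: fsbig1 => m _; apply: contrapT => ne; move/negP: nint; apply.
have [|n mE _] := @contra_ser_neq0 q v (- r - 2 - m%:~R) Tv.
  by move=> D0; apply: ne; rewrite D0 (lin0 (F_lin m)).
rewrite (_ : 2 * q - r = (m + 2 + n%:Z)%:~R) ?intr_int // !intrD -!pmulrn.
have -> : 2 * q = n%:R + r + 2 + m%:~R by move: mE; lra.
by ring.
Qed.

End ContraCoef.

(** * Identification of the double dual *)

Section ContragredientDual.
Variables (R : realType) (V : lmodType R[i]).
Variables (Y : V -> int -> V -> V) (vac omega h : V) (gamma : rat).
Hypothesis HV : voa Y vac omega.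
Hypothesis Lh : forall n : nat, Lop Y omega n%:Z h = if n == 0%N then h else 0.
Hypothesis hh : forall n : nat, Y h n%:Z h = if n == 1%N then ratr gamma *: vac else 0.
Hypothesis h_ss : semisimple ratr (Y h 0).
Variables (W : lmodType R[i]) (YW : V -> int -> W -> W).
Hypothesis MW : voa_module Y vac omega YW.

Let M : va_module Y vac Y := va_self (voa_va HV).
Let Yr v n := vam_linr M v n.
Let YWl n w := vam_linl (vm_module MW) n w.
Let omega' := omega + 2^-1 *: Lop Y omega (-1) h.
Local Notation h0 := (Y h 0).
Local Notation E := (Delta_ser Y h).
Local Notation L0 := (Lop Y omega 0).
Local Notation L1 := (Lop Y omega 1).
Local Notation L0' := (Lop Y omega' 0).
Local Notation L1' := (Lop Y omega' 1).
Local Notation Y2 := (fun v => delta_vertex Y h YW (expipi_op h0 (- 2^-1) v)).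

Let L_lin a n : linear (Lop Y a n). Proof. exact: Yr. Qed.

Let L0'E v : L0' v = L0 v - 2^-1 *: h0 v.
Proof. by rewrite (Lop_shift h HV 0) mulr1. Qed.

Let L1'E v : L1' v = L1 v - Y h 1 v.
Proof. by rewrite (Lop_shift h HV 1) mulVf ?scale1r // pnatr_eq0. Qed.

Let L0_h0 v : h0 (L0 v) = L0 (h0 v).
Proof. by have := omega_h HV Lh 0 0 v; rewrite scale0r subr0. Qed.

Lemma bigraded_ind (P : V -> Prop) : P 0 -> (forall u v, P u -> P v -> P (u + v)) ->
  (forall (lam : rat) (d : int) v,
     h0 v = ratr lam *: v -> L0 v = d%:~R *: v -> P v) -> forall v, P v.
Proof.
by apply: (bihom_ind _ _ _ h_ss (voa_grading HV)) => //; exact: intr_inj.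
Qed.

Lemma L0'_eigen lam d v : h0 v = ratr lam *: v -> L0 v = d%:~R *: v ->
  L0' v = ratr (d%:~R - 2^-1 * lam) *: v.
Proof.
move=> hv Lv; rewrite L0'E hv Lv scalerA -scalerBl; congr (_ *: _).
by rewrite rmorphB rmorphM fmorphV /= ratr_int ratr_nat.
Qed.

(** [voa_grading] indexes eigenvalues by integers, while [eigen_comp] expects rational indices. *)
Lemma L0_semisimple : semisimple ratr L0.
Proof.
apply: semisimple_gen => // P P0 PD Pe; apply: (eigen_ind (voa_grading HV)) => // d v Lv.
by apply: (Pe d%:~R); rewrite ratr_int.
Qed.

Lemma L0'_semisimple : semisimple ratr L0'.
Proof.
apply: semisimple_gen => // P P0 PD Pe; apply: bigraded_ind => // lam d v hv Lv.
exact: Pe (L0'_eigen hv Lv).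
Qed.

Let iter_weight (T : V -> V) :
  (forall v, L0 (T v) = T (L0 v) - T v) -> linear T ->
  forall (d : R[i]) n v, L0 v = d *: v -> L0 (iter n T v) = (d - n%:R) *: iter n T v.
Proof.
move=> LT lT d n v Lv; elim: n => [|n IH]; first by rewrite subr0.
rewrite iterS LT IH (linZ lT) -[X in _ - X]scale1r -scalerBl -natr1; congr (_ *: _).
by ring.
Qed.

Let L1_weight := iter_weight (L0L1 HV) (L_lin omega 1).

(** h(1) lowers the L(0)-weight by one just as L(1) does; hence L~(1) is locally nilpotent too. *)
Lemma L1'_weight (d : R[i]) n v :
  L0 v = d *: v -> L0 (iter n L1' v) = (d - n%:R) *: iter n L1' v.
Proof.
apply: iter_weight => // u; rewrite !L1'E (linB (L_lin _ _)) (L0L1 HV).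
rewrite -[1]/(1%N%:Z) -[0]/(0%N%:Z) (omega_h HV Lh) add0n scale1r /=.
by rewrite !opprB addrACA [in RHS]addrACA; congr (_ + _); rewrite addrC.
Qed.

Let iter_nil (T : V -> V) : linear T ->
  (forall (d : R[i]) n v, L0 v = d *: v -> L0 (iter n T v) = (d - n%:R) *: iter n T v) ->
  forall v, exists N, forall n, (N <= n)%N -> iter n T v = 0.
Proof. by move=> lT; apply: (weight_lowering HV) => n; exact: lin_iter. Qed.

Let L1_nil := iter_nil (L_lin omega 1) L1_weight.
Let L1'_nil := iter_nil (L_lin omega' 1) L1'_weight.

Section Pairing.
Variables (f : W -> R[i]) (u : W).
Hypothesis f_lin : linear (f : W -> R[i]^o).

Let fY (a : V) (m : int) : R[i] := f (YW a m u).
Let fY_lin m : linear (fun a => fY a m : R[i]^o).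
Proof. exact: lin_comp (YWl m u) f_lin. Qed.

Lemma contragredient_lin m : linear (fun a => contragredient Y omega YW a m f u : R[i]^o).
Proof. exact: (contra_coef_lin (L_lin _ _) (L_lin _ _) L0_semisimple L1_nil fY_lin). Qed.

Lemma contragredient_eig (d : int) v m N : L0 v = d%:~R *: v ->
  (forall n, (N <= n)%N -> iter n L1 v = 0) ->
  contragredient Y omega YW v m f u
  = \sum_(n < N) f (YW (((n`!%:R)^-1 * expipi R d%:~R) *: iter n L1 v)
                       (2 * d - m - 2 - n%:Z) u).
Proof.
move=> Lv TN.
apply: (contra_coef_eig (L_lin _ _) (L_lin _ _) L0_semisimple fY_lin) TN _.
  by rewrite ratr_int.
by rewrite intrD mulrNz intrM.
Qed.

Lemma contragredient_dual_pairing v r :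
  f (Y2 v r u) = contra_coef L1' L0'
    (fun a m => contragredient Y omega YW a m f u) v r.
Proof.
have lL : linear (fun v => f (Y2 v r u) : R[i]^o).
  apply: (lin_comp (f := fun v => Y2 v r u)) f_lin.
  exact: lin_comp (expipi_op_lin (Yr _ _) h_ss _)
    (delta_vertex_linl HV Lh hh h_ss (vm_module MW) r u).
have lR := contra_coef_lin (L_lin omega' 1) (L_lin omega' 0) L0'_semisimple L1'_nil
  contragredient_lin r.
move: v; apply: bigraded_ind => [|x y IHx IHy|lam d v hv Lv].
- by rewrite (lin0 lL) (lin0 lR).
- by rewrite (linD lL) (linD lR) IHx IHy.
rewrite (expipi_op_eig (Yr _ _) h_ss _ hv).
rewrite (linZ (delta_vertex_linl HV Lh hh h_ss (vm_module MW) r u)).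
have L0'v := L0'_eigen hv Lv.
set q := d%:~R - 2^-1 * lam in L0'v.
(* As q = d - lam/2, both sides are supported on the same coset r in -lam + Z. *)
have qE : 2 * q - r = (2 * d)%:~R - (r + lam).
  by rewrite /q intrM -[2%:~R]/(2 : rat); field.
have [/intrP[m rm]|nint] := boolP (r + lam \is a Num.int); last first.
  rewrite (delta_vertex_eigen0 HV hh h_ss (vm_module MW) _ hv nint) scaler0.
  rewrite (lin0 f_lin); apply/esym.
  apply: (contra_coef_eig0 (L_lin _ _) (L_lin _ _) L0'_semisimple contragredient_lin L0'v).
  by rewrite qE rpredBl ?intr_int.
(* One bound is needed for the iterates of L~(1) on v and for those of L(1) on the finitely many
   nonzero vectors L~(1)^n v. *)
have [N1 HN1] := L1'_nil v.
have [N2 HN2] : exists T, forall n t, (n < N1)%N -> (T <= t)%N ->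
    iter t L1 (iter n L1' v) = 0.
  by apply: bound_uniform => n; exact: L1_nil.
pose N := maxn N1 N2.
have N1v n : (N <= n)%N -> iter n L1' v = 0.
  by move=> Nn; apply: HN1; rewrite /N in Nn; lia.
have N2v n t : (N <= t)%N -> iter t L1 (iter n L1' v) = 0.
  move=> Nt; have [nN|/HN1->] := ltnP n N1; last exact: lin0 (lin_iter _ (L_lin _ _)).
  by apply: HN2 => //; rewrite /N in Nt; lia.
rewrite (contra_coef_eig (L_lin _ _) (L_lin _ _) L0'_semisimple contragredient_lin
  L0'v N1v (m := 2 * d - m)); last by rewrite qE rm intrD mulrNz.
(* The terms of e^(xL(1)) e^(-xL~(1)) v; the sign appears because [Delta_ser_exp] is expressed with
   h(1) - L(1) = -L~(1). *)
pose G i j := ((i`!%:R)^-1 * ((j`!%:R)^-1 * (-1) ^+ j)) *: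
  iter i L1 (iter j L1' v).
have EG c : E c v = \sum_(i < c.+1) G i (c - i)%N.
  rewrite (Delta_ser_exp HV Lh hh); apply: eq_bigr => i _.
  have -> j : iter j (fun u => Y h 1 u - L1 u) v = (-1) ^+ j *: iter j L1' v.
    elim: j => [|j IH]; first by rewrite scale1r.
    rewrite !iterS IH L1'E (linZ (Yr _ _)) (linZ (L_lin _ _)) -scalerBr exprS.
    by rewrite mulN1r scaleNr -scalerN opprB.
  by rewrite /G !(linZ (lin_iter _ (L_lin _ _))) !scalerA !mulrA.
have G0 i j : (N <= i)%N || (N <= j)%N -> G i j = 0.
  rewrite /G; have [/N1v->|_] := leqP N j.
    by rewrite (lin0 (lin_iter _ (L_lin _ _))) scaler0.
  by rewrite orbF => /N2v->; rewrite scaler0.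
have E0 c : (N + N <= c)%N -> E c v = 0.
  move=> Nc; rewrite EG; apply: big1 => i _; have ic := ltn_ord i.
  by apply: G0; lia.
rewrite (delta_vertex_eigen HV hh h_ss (vm_module MW) u hv E0 rm).
rewrite (_ : \sum_(n < N + N) _ = \sum_(i < N) \sum_(j < N)
    YW (G i j) (m - (i + j)%N%:Z) u); last first.
  rewrite -(@sum_box _ (fun i j => YW (G i j) (m - (i + j)%N%:Z) u) N N (N + N)) //.
    apply: eq_bigr => c _; rewrite EG (lin_sum (YWl _ _)); apply: eq_bigr => i _.
    by rewrite subnKC // -ltnS.
  by move=> i j /G0->; rewrite (lin0 (YWl _ _)).
rewrite exchange_big (linZ f_lin) (lin_sum f_lin) scaler_sumr.
apply: eq_bigr => j _ /=.
(* The outer dual hands a vector of L(0)-weight d - j to the inner one, whose phase is therefore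
   e^(pi i (d-j)). *)
have Lj : L0 (((j`!%:R)^-1 * expipi R q) *: iter j L1' v)
    = (d - j%:Z)%:~R *: (((j`!%:R)^-1 * expipi R q) *: iter j L1' v).
  rewrite (linZ (L_lin _ _)) (L1'_weight _ Lv) !scalerA; congr (_ *: _).
  by rewrite intrD mulrNz -pmulrn; ring.
rewrite (contragredient_eig _ Lj (N := N)); last first.
  by move=> n Nn; rewrite (linZ (lin_iter _ (L_lin _ _))) N2v // scaler0.
rewrite (lin_sum f_lin) scaler_sumr; apply: eq_bigr => i _.
rewrite (_ : 2 * (d - j%:Z) - (2 * d - m - 2 - j%:Z) - 2 - i%:Z = m - (i + j)%N%:Z);
  last by lia.
rewrite (linZ (lin_iter _ (L_lin _ _))) !(linZ (YWl _ _)) !(linZ f_lin) !scalerA.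
congr (_ *: _).
(* The exponents (d - j) + q + j add up to 2d - lam/2, and e^(2 pi i d) = 1. *)
have -> : expipi R (- 2^-1 * lam) = expipi R (d - j%:Z)%:~R * expipi R q * (-1) ^+ j.
  rewrite -expipi_nat -!expipiD; rewrite -[LHS]mulr1 -(expipi_2int R d) -expipiD.
  by congr expipi; rewrite /q intrD mulrNz -pmulrn; ring.
have : (-1) ^+ j * (-1) ^+ j = 1 :> R[i] by rewrite -exprMn mulrNN mulr1 expr1n.
move: ((-1) ^+ j) => s ss; rewrite -[RHS]mulr1 -[X in _ = _ * X]ss.
by ring.
Qed.
End Pairing.

(** The pairing shows that the [xget] has a witness; separation of points by the restricted dual
    shows that every witness is equal to it. *)
Lemma contragredient_dualE v r u :
  contragredient_dual Y omega YW omega' v r u = Y2 v r u.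
Proof.
rewrite /contragredient_dual; case: xgetP => [x _ Hx|/(_ (Y2 v r u))[]]; last first.
  by move=> f [f_lin _]; exact: contragredient_dual_pairing.
apply: contrapT => /eqP; rewrite -subr_eq0 => /eqP /(weight_graded_separates
  (vam_linr (vm_module MW) _ _) (vm_graded MW))[f [f_lin f_fin]]; apply.
have l : linear (f : W -> R[i]^o) by [].
apply/eqP; rewrite (linB l) subr_eq0; apply/eqP.
by rewrite Hx // contragredient_dual_pairing.
Qed.

End ContragredientDual.

Theorem theorem2p6 (R : realType) (V : lmodType R[i])
    (Y : V -> int -> V -> V) (vac omega h : V) (gamma : rat) (k : nat)
    (W : lmodType R[i]) (YW : V -> int -> W -> W)
    (sigma_h := expipi_op (Y h 0) 2)
    (omega' := omega + 2^-1 *: Lop Y omega (-1) h)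
    (Y1 := contragredient_dual Y omega YW omega')
    (Y2 := fun v : V =>
       subst_vertex YW (Delta Y h (expipi_op (Y h 0) (- 2^-1) v))) :
  voa Y vac omega ->
  (forall n : nat, Lop Y omega n%:Z h = if n == 0%N then h else 0) ->
  (forall n : nat, Y h n%:Z h = if n == 1%N then ratr gamma *: vac else 0) ->
  semisimple ratr (Y h 0) ->
  has_order sigma_h k ->
  voa_module Y vac omega YW ->
  [/\ twisted_module Y vac sigma_h k Y1,
      twisted_module Y vac sigma_h k Y2,
      weight_graded (Y1 omega 1) <-> weight_graded (Y2 omega 1)
    & twisted_isomorphic Y1 Y2].
Proof.
move=> HV Lh hh h_ss sigma_k MW.
have Y12 : Y1 = Y2.
  apply/funext => v; apply/funext => r; apply/funext => u.
  exact: (contragredient_dualE HV Lh hh h_ss MW).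
have Y2_twisted : twisted_module Y vac sigma_h k Y2.
  exact: (delta_vertex_twisted HV Lh hh h_ss (vm_module MW) sigma_k).
rewrite Y12; split=> //.
by exists (@idfun W : {linear W -> W}); split=> //; exists idfun.
Qed.
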